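(* Fix $N\in\mathbb{N}$. (i) If $Y_1,\ldots,Y_{2N-1}$ are infinite dimensional Banach spaces, then $Sz(\widehat{\otimes}_{\pi,i=1}^{2N-1}Y_i)>\omega^{N-1}$. (ii) If $Y_1,\ldots,Y_{2N}$ are infinite dimensional Banach spaces, then $\widehat{\otimes}_{\pi,i=1}^{2N}Y_i$ does not have property $\mathfrak{A}_{N-1,p}$ for any $2<p\leqslant\infty$.
   Context: Banach spaces are over $\mathbb{R}$ or $\mathbb{C}$. $\widehat{\otimes}_\pi$ is the completed projective tensor product; $\widehat{\otimes}_{\pi,i=1}^kY_i=Y_1\widehat{\otimes}_\pi\cdots\widehat{\otimes}_\pi Y_k$. Szlenk index: for a weak$^*$-compact $K\subset X^*$ and $\varepsilon>0$, $s_\varepsilon(K)$ is the set of $x^*\in K$ such that $\mathrm{diam}(K\cap V)>\varepsilon$ for every weak$^*$-neighborhood $V$ of $x^*$; $s^0_\varepsilon(K)=K$, $s_\varepsilon^{\xi+1}(K)=s_\varepsilon(s_\varepsilon^\xi(K))$, and intersections are taken at limit ordinals. $Sz(K,\varepsilon)=\min\{\xi:s^\xi_\varepsilon(K)=\varnothing\}$, $Sz(X)=\sup_{\varepsilon>0}Sz(B_{X^*},\varepsilon)$, with $Sz(X)=\infty$ if some $Sz(B_{X^*},\varepsilon)$ is undefined; by convention $\xi<\infty$ for every ordinal $\xi$. Weakly summing norms: $\|(x_i)_{i=1}^n\|_q^w=\sup_{x^*\in B_{X^*}}(\sum_{i=1}^n|x^*(x_i)|^q)^{1/q}$ for $1\leqslant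 q<\infty$. Trees: $\Lambda^{<\omega}$ is the set of finite sequences in a set $\Lambda$ (including $\varnothing$), with $\prec$ the relation of being a proper initial segment; $s^-$ is the maximal proper initial segment of $s\neq\varnothing$. A tree is a set $T\subset\Lambda^{<\omega}$ with $\varnothing\notin T$ such that $\varnothing\prec s\preceq t\in T$ implies $s\in T$. For $T\subset\Lambda^{<\omega}$, $MAX(T)$ is the set of $\preceq$-maximal members, $T'=T\setminus MAX(T)$, $T^0=T$, $T^{\xi+1}=(T^\xi)'$, with intersections at limits; $\mathrm{rank}(T)$ is the least $\xi$ with $T^\xi=\varnothing$. For a tree $T$, $(x_t)_{t\in T}\subset X$ is weakly null if for every ordinal $\zeta$ and $t\in(\{\varnothing\}\cup T)^{\zeta+1}$, $0$ is in the weak closure of $\{x_s:s\in T^\zeta,s^-=t\}$. Property $\mathfrak{A}_{M,p}$ ($M\in\{0,1,2,\ldots\}$, $1<p\leqslant\infty$, $1/p+1/q=1$): there is a constant $\alpha$ such that for every $n\in\mathbb{N}$, every tree $T$ with $\mathrm{rank}(T)=\omega^Mn$ and every weakly null $(x_t)_{t\in T}\subset B_X$, there exist $\varnothing=t_0\prec t_1\prec\cdots\prec t_n$ and $u_1,\ldots,u_n$ such that, for each $1\leqslant i\leqslant n$, $t_i\in MAX(T^{\omega^M(n-i)})$, $u_i$ is in the convex hull of $\{x_t:t_{i-1}\prec t\preceq t_i\}$, and $\|(u_i)_{i=1}^n\|_q^w\leqslant\alpha$. *)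

(* Defs.v *)
From HB Require Import structures.
From mathcomp Require Import all_boot all_order all_algebra.
From mathcomp Require Import all_classical all_reals all_analysis.
From mathcomp Require Import complex.

Set Implicit Arguments.
Unset Strict Implicit.
Unset Printing Implicit Defensive.

Import Order.TTheory GRing.Theory Num.Theory.
Import numFieldNormedType.Exports.

Local Open Scope classical_set_scope.
Local Open Scope ring_scope.

(** ** Ordinals *)

(* A term of [tord] is a notation for an ordinal; [OSup _ f] denotes the
   supremum of the nonempty family [f], which need not be increasing.  Several
   terms may denote the same ordinal, so ordinals are compared with [ole], never
   with [=]. *)
Inductive tord : Type :=
| OZero
| OSucc of tord
| OSup (I : Type) of inhabited I & (I -> tord).

(* [has_pred P b]: some [c] with [c + 1 <= b] satisfies [P], for [P] an initial
   segment of the ordinals. *)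
Fixpoint has_pred (P : tord -> Prop) (b : tord) : Prop :=
  match b with
  | OZero => False
  | OSucc c => P c
  | OSup _ _ f => exists i, has_pred P (f i)
  end.

Fixpoint ole (a b : tord) : Prop :=
  match a with
  | OZero => True
  | OSucc a' => has_pred (ole a') b
  | OSup _ _ f => forall i, ole (f i) b
  end.

Definition olt (a b : tord) : Prop := ole (OSucc a) b.

(* [None] stands for the symbol [oo], which is larger than all ordinals. *)
Definition olt_infty (a : tord) (b : option tord) : Prop :=
  if b is Some b' then olt a b' else True.

Fixpoint oadd (a b : tord) : tord :=
  match b with
  | OZero => a
  | OSucc b' => OSucc (oadd a b')
  | OSup _ h f => OSup h (fun i => oadd a (f i))
  end.

Fixpoint omul (a b : tord) : tord :=
  match b with
  | OZero => OZero
  | OSucc b' => oadd (omul a b') a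
  | OSup _ h f => OSup h (fun i => omul a (f i))
  end.

Definition ofin (n : nat) : tord := iter n OSucc OZero.

Definition oomega : tord := OSup (inhabits 0%N) ofin.

Definition omega_pow (n : nat) : tord :=
  iter n (fun a => omul a oomega) (ofin 1).

Definition is_least (P : tord -> Prop) (a : tord) : Prop :=
  P a /\ forall b, P b -> ole a b.

Lemma has_pred_mono (P Q : tord -> Prop) b :
  (forall c, P c -> Q c) -> has_pred P b -> has_pred Q b.
Proof.
move=> PQ; elim: b => [//|b _|I h f IH] /=; first exact: PQ.
by case=> i /IH ?; exists i.
Qed.

Lemma ole_sup I (h : inhabited I) (f : I -> tord) a i :
  ole a (f i) -> ole a (OSup h f).
Proof.
elim: a => [//|a _|J k g IH] /=; first by exists i.
by move=> H j; exact/IH/H.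
Qed.

Lemma ole_refl a : ole a a.
Proof.
elim: a => [//|a IH|I h f IH] //= i.
exact: (@ole_sup I h f (f i) i).
Qed.

Lemma has_predP P b : has_pred P b -> exists2 c, P c & olt c b.
Proof.
elim: b => [//|b _|I h f IH] /=.
  by move=> Pb; exists b => //; exact: ole_refl.
case=> i /IH[c Pc cf]; exists c => //.
exact: (@ole_sup I h f (OSucc c) i cf).
Qed.

Lemma ole_trans b a c : ole a b -> ole b c -> ole a c.
Proof.
elim: a b c => [//|a IH|I h f IH] b c; last first.
  by move=> /= ab bc i; exact: IH (ab i) bc.
elim: b c => [//|b _|J k g IHb] c /=; last by case=> j H /(_ j); exact: IHb.
by move=> ab; apply: has_pred_mono => d; exact: IH.
Qed.

Lemma ole_succ a : ole a (OSucc a).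
Proof.
elim: a => [//|a IH|I h f IH] //= i.
apply: ole_trans (IH i) _ => /=.
exact: (@ole_sup I h f (f i) i (ole_refl _)).
Qed.

Lemma ole_total a b : ole a b \/ olt b a.
Proof.
elim: a b => [|a IH|I h f IH] b; first by left.
- elim: b => [|b _|J k g IHb].
  + by right.
  + by case: (IH b) => H; [left|right].
  + have [[j H]|H] := pselect (exists j, ole (OSucc a) (g j)).
      by left; exists j.
    by right => /= j; case: (IHb j) => // H'; case: H; exists j.
- have [H|/existsNP[i H]] := pselect (forall i, ole (f i) b); first by left.
  by right; exists i; case: (IH i b).
Qed.

Lemma is_least_exists (P : tord -> Prop) :
  (exists a, P a) -> exists a, is_least P a.
Proof.
case=> a Pa; suff : forall b, ole b a -> P b -> exists c, is_least P c.
  by apply; [exact: ole_refl|exact: Pa].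
move=> {Pa}; elim: a => [|a IH|I h f IH] b ba Pb.
- by exists b; split=> // c _; exact: ole_trans ba _.
- have [[c Pc ca]|H] := pselect (exists2 c, P c & ole c a); first exact: IH Pc.
  exists b; split=> // c Pc; apply: ole_trans ba _.
  by case: (ole_total c a) => // ca; case: H; exists c.
- have [[c Pc [i ci]]|H] := pselect (exists2 c, P c & exists i, ole c (f i)).
    exact: IH ci Pc.
  exists b; split=> // c Pc; apply: ole_trans ba _ => i.
  case: (ole_total c (f i)) => [ci|]; first by case: H; exists c => //; exists i.
  exact: ole_trans (ole_succ _).
Qed.

(* The least ordinal satisfying [P], or [None] if there is none. *)
Definition omin (P : tord -> Prop) : option tord :=
  match pselect (exists a, P a) with
  | left h => Some (sval (cid (is_least_exists h)))
  | right _ => None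
  end.

(** ** Transfinite iteration of a derivation *)

Fixpoint derived (S : Type) (d : set S -> set S) (A : set S) (xi : tord) :
    set S :=
  match xi with
  | OZero => A
  | OSucc zeta => d (derived d A zeta)
  | OSup _ _ f => \bigcap_i derived d A (f i)
  end.

(* For the derivations used below, [derived d A xi] depends only on the ordinal
   denoted by [xi], and [derived d A (OSup _ f)] is its value at the supremum of
   [f] even when that supremum is not a limit ordinal. *)
Lemma derived_ole (S : Type) (d : set S -> set S) (A : set S) a b :
  (forall B, d B `<=` B) -> {homo d : B C / B `<=` C} ->
  ole a b -> derived d A b `<=` derived d A a.
Proof.
move=> dsub dmono.
have sub0 : forall b, derived d A b `<=` A.
  elim=> [//|c IH|I h f IH] /=; first exact: subset_trans (dsub _) IH.
  by case: h => i x H; apply: (IH i); exact: H.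
elim: a b => [b _|a IH|I h f IH] /=.
- exact: sub0.
- elim=> [//|b _|J k g IHb] /=; first by move=> /IH; exact: dmono.
  by case=> j /IHb H x Hx; apply: H; exact: Hx.
- by move=> b H x Hx i _; exact: IH (H i) _ Hx.
Qed.

(** ** Scalars *)

(* The scalar field [K] is [R] or [R[i]].  Norms of normed modules over [K] are
   elements of [K]; [re] reads them as elements of [R]. *)
Variant real_or_complex (R : realType) :
    forall K : numFieldType, (K -> R) -> Prop :=
| RealScalars : @real_or_complex R R id
| ComplexScalars : @real_or_complex R (complex R) (@complex.Re R).

(** ** Trees *)

Section trees.
Context {L : eqType}.
Implicit Types (s t : seq L) (T : set (seq L)).

Definition proper_prefix s t : bool := prefix s t && (s != t).

Definition parent s : seq L := take (size s).-1 s.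

Definition is_tree T : Prop :=
  ~ T [::] /\ forall s t, proper_prefix [::] s -> prefix s t -> T t -> T s.

Definition tree_max T : set (seq L) :=
  [set s | T s /\ forall t, T t -> prefix s t -> t = s].

Definition tree_deriv T : set (seq L) := T `\` tree_max T.

Definition tree_derived T (xi : tord) : set (seq L) := derived tree_deriv T xi.

Definition has_rank T (xi : tord) : Prop :=
  is_least (fun zeta => tree_derived T zeta = set0) xi.

End trees.

(** ** Banach space notions *)

Section banach.
Context {R : realType} {K : numFieldType} (re : K -> R).

Definition rnorm (V : normedModType K) (v : V) : R := re `|v|.

Definition infinite_dimensional (V : lmodType K) : Prop :=
  ~ exists n (e : 'I_n -> V), forall v, exists c : 'I_n -> K,
      v = \sum_(i < n) c i *: e i.

Definition convex_hull (V : lmodType K) (A : set V) : set V :=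
  [set v | exists n (c : 'I_n -> K) (a : 'I_n -> V),
    [/\ forall i, 0 <= c i, \sum_(i < n) c i = 1, forall i, A (a i) &
        v = \sum_(i < n) c i *: a i]].

Section dual.
Variable X : normedModType K.

Definition unit_ball : set X := [set x | `|x| <= 1].

(* The topology of [{ptws X -> K^o}] induces the weak-star topology on [dual]. *)
Definition dual : set {ptws X -> K^o} :=
  [set f | linear (f : X -> K^o) /\ continuous (f : X -> K^o)].

Definition dual_norm (f : X -> K^o) : \bar R :=
  ereal_sup [set (rnorm (f x))%:E | x in unit_ball].

Definition dual_ball : set {ptws X -> K^o} :=
  dual `&` [set f | (dual_norm f <= 1)%E].

Definition dual_diam (A : set {ptws X -> K^o}) : \bar R :=
  ereal_sup [set dual_norm (fun x => p.1 x - p.2 x) | p in A `*` A].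

(** *** Szlenk index *)

Definition szlenk_deriv (eps : R) (A : set {ptws X -> K^o}) :
    set {ptws X -> K^o} :=
  [set f | A f /\ forall V, nbhs f V -> (eps%:E < dual_diam (A `&` V))%E].

Definition szlenk_at (A : set {ptws X -> K^o}) (eps : R) : option tord :=
  omin (fun xi => derived (szlenk_deriv eps) A xi = set0).

Definition szlenk : option tord :=
  if pselect (exists eps : {posnum R}, szlenk_at dual_ball eps%:num = None)
  then None
  else Some (OSup (inhabits (1%:pos : {posnum R})) (fun eps : {posnum R} =>
         odflt OZero (szlenk_at dual_ball eps%:num))).

(** *** Weakly null trees *)

Definition dual_eval (x : X) : {ptws set_type dual -> K^o} :=
  fun f => \val f x.

Definition weak_closure (A : set X) : set X :=
  closure (A : set (initial_topology dual_eval)).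

Definition weakly_null (L : eqType) (T : set (seq L)) (x : seq L -> X) : Prop :=
  forall (zeta : tord) t,
    tree_derived ([set [::]] `|` T) (OSucc zeta) t ->
    weak_closure [set x s | s in [set s | tree_derived T zeta s /\
                                          parent s = t]] 0.

(** *** Weakly summing norms and property A *)

Definition weakly_summing_norm (q : R) (n : nat) (x : 'I_n -> X) : \bar R :=
  ereal_sup [set ((\sum_(i < n) (rnorm (f (x i) : K^o)) `^ q) `^ q^-1)%:E
            | f in dual_ball].

(* For [1 < p <= +oo]; the conjugate exponent is then a real number. *)
Definition property_A (M : nat) (p : \bar R) : Prop :=
  exists alpha : R, forall n : nat, (0 < n)%N ->
  forall (L : eqType) (T : set (seq L)) (x : seq L -> X),
    is_tree T -> has_rank T (omul (omega_pow M) (ofin n)) ->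
    (forall s, T s -> unit_ball (x s)) -> weakly_null T x ->
  exists (t : 'I_n.+1 -> seq L) (u : 'I_n -> X),
    [/\ t ord0 = [::],
        (* [t (lift ord0 i)] is the successor of [t (widen_ord _ i)]; the index
           [i] here is the index [i + 1] of the convention [1 <= i <= n]. *)
        forall i : 'I_n,
          let a := t (widen_ord (leqnSn n) i) in
          let b := t (lift ord0 i) in
          [/\ proper_prefix a b,
              tree_max (tree_derived T
                (omul (omega_pow M) (ofin (n - i.+1)))) b &
              convex_hull [set x s | s in [set s | proper_prefix a s /\
                                                   prefix s b]] (u i)] &
        (weakly_summing_norm (fine (hoelder_conjugate p)) u <= alpha%:E)%E].

End dual.

(** ** Projective tensor products *)

Section projective.
Context {k : nat} (Y : 'I_k -> completeNormedModType K).

Definition multilinear (W : lmodType K) (phi : (forall i, Y i) -> W) : Prop :=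
  forall (i : 'I_k) (y : forall j, Y j),
    linear (fun z : Y i => phi (eqtype.dfwith y z)).

(* A list [u] of elements of the product represents the element
   [\sum_(y <- u) y_1 (x) ... (x) y_k] of the algebraic tensor product (scalars
   can be absorbed in the [y_i] when [k > 0]).  As usual, a tensor is identified
   with the functional on multilinear forms that it induces. *)
Definition same_tensor (u v : seq (forall i, Y i)) : Prop :=
  forall phi : (forall i, Y i) -> K^o, multilinear phi ->
    \sum_(y <- u) phi y = \sum_(y <- v) phi y.

Definition projective_norm (u : seq (forall i, Y i)) : R :=
  inf [set \sum_(y <- v) \prod_(i < k) rnorm (y i) | v in same_tensor u].

(* [Z], with [tau] as the map (y_1, ..., y_k) |-> y_1 (x) ... (x) y_k, is a
   completion of the algebraic tensor product of the [Y i] with respect to the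
   projective norm.  This determines ([Z], [tau]) up to a unique isometric
   isomorphism. *)
Definition is_projective_tensor_product (Z : completeNormedModType K)
    (tau : (forall i, Y i) -> Z) : Prop :=
  [/\ multilinear tau,
      forall u, rnorm (\sum_(y <- u) tau y) = projective_norm u &
      dense (range (fun u : seq (forall i, Y i) => \sum_(y <- u) tau y))].

End projective.

End banach.

(* Main.v *)
Require Import Defs.
From mathcomp Require Import all_boot all_order all_algebra.
From mathcomp Require Import all_classical all_reals all_analysis.
From mathcomp Require Import perm complex ring lra zify.
Import Order.TTheory GRing.Theory Num.Theory.
Import numFieldNormedType.Exports.

Set Implicit Arguments.
Unset Strict Implicit.
Unset Printing Implicit Defensive.

Local Open Scope classical_set_scope.
Local Open Scope ring_scope.

(** The proof superposes copies of bounded forms along pairs of factors.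

    On an infinite-dimensional space there are, for every [n], functionals
    [f_0, ..., f_(n-1)] with [\sum_a |f_a y|^2 <= |y|^2] and vectors [v_a] of
    the unit ball with [f_a v_a = 1/2] and [f_a v_b = 0] for [b < a]
    ([dvoretzky_rogers], a volume argument).  Take such a system [(f, v)] on one
    factor and a reversed one [(g, w)], with [g_a w_b = 0] for [a < b], on
    another.  By Cauchy-Schwarz
    [\sum_a |f_a y| |g_a y'| <= |y| |y'|], so the form
    [\sum_a f_a (x) g_a (x) phi_a] has norm at most 1 whenever all the forms
    [phi_a] on the remaining factors do, and its restriction to
    [v_b (x) w_b (x) _] only sees [phi_b].  A pair of factors thus carries [n]
    separated copies of what the remaining factors carry, without loss of norm
    and for every [n]; this multiplies the ordinal ranks by [omega].

    Iterating over [M] pairs, the summands are indexed by words of [M] pairs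
    [(n, a)] with [a < n], where the size [n] of a system may depend on the
    earlier letters.  These words ([digits]) are compared lexicographically,
    within systems of equal sizes, and the letters [a] are the coefficients of
    an ordinal below [omega^M] in Cantor normal form ([oval]); every smaller
    ordinal is dominated by the value of a smaller word ([oval_cofinal]).  For
    a decreasing chain of words and arbitrary norm-one functionals [h_d] on the
    last factor, the sum of the forms attached to the words is bounded by 1
    ([chain_form_bound]), and the form of a word vanishes on the elementary
    tensors attached to the other words of the chain ([digit_form_comparable]).

    Szlenk index, [2 M + 1] factors.  Extending a chain by one word [d] adds
    a form [G_d (x) h], where [h] is a norm-one functional on the last factor
    that may be required to vanish at any finitely many points.  Such forms
    accumulate weak-star at 0 and have norm bounded below, so the functional of
    a chain survives as many derivations as the ordinal of its last word, and
    the functional 0 of the empty chain survives [omega^M] of them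
    ([szlenk_odd_tensor_product]).

    Property A, [2 M + 2] factors.  The extra factor carries a single system of
    size [n], for which only [\sum_a |f_a y| <= sqrt n |y|] is available.  The
    decreasing chains of words, now with an additional first letter [(n, a)] and
    with a norm-one vector of the last factor attached to each word, form a tree
    of rank [omega^M n], and the elementary tensors attached to the last words
    of its nodes are weakly null.  On each branch, after a choice of signs, a
    functional of norm at most 1 is at least of order [1 / sqrt n] in modulus on
    all the convex blocks, so their weakly [q]-summing norm is at least of
    order [n^(1/q - 1/2)], which is unbounded when [q < 2]
    ([weakly_null_tree_lower_estimate], [property_A_fails]). *)

(** * Real and complex scalars *)

(** The structure shared by the scalar fields [R] and [R[i]]: the embedding of
    the reals and the conjugation, through which both cases are treated at
    once. *)
Record scalars (R : realType) (K : numFieldType) (re : K -> R) := Scalars {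
  emb : {rmorphism R -> K};
  cj : {rmorphism K -> K};
  reD : {morph re : x y / x + y};
  reM : forall r x, re (emb r * x) = r * re x;
  re_emb : forall r, re (emb r) = r;
  emb_re : forall x, 0 <= x -> emb (re x) = x;
  emb_ge0 : forall r, (0 <= emb r) = (0 <= r);
  mul_cj : forall x, x * cj x = emb (re `|x| ^+ 2);
  cj_emb : forall r, cj (emb r) = emb r;
  cjK : involutive cj
}.

Lemma scalars_exist (R : realType) (K : numFieldType) (re : K -> R) :
  real_or_complex re -> inhabited (scalars re).
Proof.
case.
- constructor; apply: (@Scalars R R id idfun idfun) => //= x.
  by rewrite real_normK ?num_real// expr2.
- pose C : numFieldType := complex R.
  pose e : {rmorphism R -> C} := real_complex R.
  pose c : {rmorphism C -> C} := @conjc R.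
  constructor; apply: (@Scalars R C (@complex.Re R) e c) => //=.
  + by move=> [a b] [a' b'].
  + by move=> r [a b] /=; rewrite mul0r subr0.
  + by move=> x x0; exact: RRe_real (ger0_real x0).
  + by move=> r; rewrite [LHS]lecR.
  + move=> x; rewrite -sqr_normc [RHS]rmorphXn/=; congr (_ ^+ 2).
  + exact: conjc_real.
  + exact: conjcK.
Qed.

(** * Real-valued norms *)

Section norms.
Variables (R : realType) (K : numFieldType) (re : K -> R) (S : scalars re).

Lemma re_ge0 x : 0 <= x -> 0 <= re x.
Proof. by move=> x0; rewrite -(emb_ge0 S) (emb_re S). Qed.

Lemma emb_le r s : (emb S r <= emb S s) = (r <= s).
Proof. by rewrite -subr_ge0 -rmorphB (emb_ge0 S) subr_ge0. Qed.

Lemma re_le x y : 0 <= x -> x <= y -> re x <= re y.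
Proof.
by move=> x0 xy; rewrite -emb_le !(emb_re S)//; exact: le_trans xy.
Qed.

Lemma re0 : re 0 = 0. Proof. by rewrite -(rmorph0 (emb S)) (re_emb S). Qed.
Lemma re1 : re 1 = 1. Proof. by rewrite -(rmorph1 (emb S)) (re_emb S). Qed.

Variable V : normedModType K.
Implicit Types v w : V.

Lemma emb_rnorm v : emb S (rnorm re v) = `|v|.
Proof. by rewrite (emb_re S). Qed.

Lemma rnorm_ge0 v : 0 <= rnorm re v.
Proof. exact: re_ge0. Qed.

Lemma rnorm0 : rnorm re (0 : V) = 0.
Proof. by rewrite /rnorm normr0 re0. Qed.

Lemma rnorm_eq0 v : rnorm re v = 0 -> v = 0.
Proof. by move=> H; apply/normr0_eq0; rewrite -emb_rnorm H rmorph0. Qed.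

Lemma rnormN v : rnorm re (- v) = rnorm re v.
Proof. by rewrite /rnorm normrN. Qed.

Lemma rnormD v w : rnorm re (v + w) <= rnorm re v + rnorm re w.
Proof. by rewrite /rnorm -(reD S); exact/re_le/ler_normD. Qed.

Lemma rnormB v w : rnorm re (v - w) <= rnorm re v + rnorm re w.
Proof. by rewrite -(rnormN w); exact: rnormD. Qed.

Lemma rnorm_sum (I : Type) (s : seq I) (P : pred I) (F : I -> V) :
  rnorm re (\sum_(j <- s | P j) F j) <= \sum_(j <- s | P j) rnorm re (F j).
Proof.
elim/big_rec2: _ => [|j x y _ IH]; first by rewrite rnorm0.
by apply: le_trans (rnormD _ _) _; rewrite lerD2l.
Qed.

Lemma rnormZ (a : K) v : rnorm re (a *: v) = rnorm re (a : K^o) * rnorm re v.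
Proof. by rewrite /rnorm normrZ -[in LHS](emb_re S (normr_ge0 a)) (reM S). Qed.

Lemma rnormM (a b : K) :
  rnorm re (a * b : K^o) = rnorm re (a : K^o) * rnorm re (b : K^o).
Proof. by rewrite /rnorm normrM -[in LHS](emb_re S (normr_ge0 a)) (reM S). Qed.

Lemma rnorm_emb r : 0 <= r -> rnorm re (emb S r : K^o) = r.
Proof.
by move=> r0; rewrite /rnorm ger0_norm ?(emb_ge0 S)// (re_emb S).
Qed.

Lemma rnorm_le1 v : (`|v| <= 1) = (rnorm re v <= 1).
Proof. by rewrite -emb_rnorm -(rmorph1 (emb S)) emb_le. Qed.

Lemma rnorm_prod (I : Type) (s : seq I) (P : pred I) (F : I -> K) :
  rnorm re (\prod_(j <- s | P j) F j : K^o) =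
  \prod_(j <- s | P j) rnorm re (F j : K^o).
Proof.
elim/big_rec2: _ => [|j x y _ IH]; first by rewrite /rnorm normr1 re1.
by rewrite rnormM IH.
Qed.

End norms.
(** * The Hahn-Banach theorem *)
Section real_hahn_banach.
Variables (R : realType) (K : numFieldType) (i : {rmorphism R -> K}).
Variables (V : lmodType K) (p : V -> R).
Hypothesis pD : forall v w, p (v + w) <= p v + p w.
Hypothesis pZ : forall r v, 0 <= r -> p (i r *: v) = r * p v.

Definition real_linear_graph (G : set (V * R)) : Prop :=
  G (0, 0) /\
  forall r x y, G x -> G y -> G (i r *: x.1 + y.1, r * x.2 + y.2).

Let good (G : set (V * R)) : Prop :=
  real_linear_graph G /\ forall x, G x -> x.2 <= p x.1.

Let p0 : p 0 = 0.
Proof. by rewrite -(scale0r (0 : V)) -(rmorph0 i) pZ// mul0r. Qed.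

(** Domination alone makes the graph single-valued: two values at [v] put
    [(0, a - b)] and [(0, b - a)] in the graph. *)
Let good_unique G v a b : good G -> G (v, a) -> G (v, b) -> a = b.
Proof.
move=> [[_ Glin] Gdom] Ga Gb.
have aux a' b' : G (v, a') -> G (v, b') -> a' <= b'.
  move=> Ha Hb; have := Gdom _ (Glin (-1) _ _ Hb Ha).
  by rewrite /= rmorphN rmorph1 scaleN1r addNr p0 mulN1r addrC subr_le0.
by apply/eqP; rewrite eq_le !aux.
Qed.

(** The one-dimensional extension step: the values admissible at [v] form a
    nonempty interval, because [b - p (w - v) <= p (w' + v) - b'] for all
    [(w, b)] and [(w', b')] in the graph. *)
Let good_extend G v : good G -> (forall a, ~ G (v, a)) ->
  exists2 G', good G' & G `<` G'.
Proof.
move=> [[G0 Glin] Gdom] Gv.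
have GZ r x : G x -> G (i r *: x.1, r * x.2).
  by move=> Gx; have := Glin r _ _ Gx G0; rewrite /= !addr0.
pose B := [set x.2 - p (x.1 - v) | x in G].
have key x y : G x -> G y -> x.2 - p (x.1 - v) <= p (y.1 + v) - y.2.
  move=> Gx Gy; rewrite lerBlDr addrAC lerBrDr.
  have := Gdom _ (Glin 1 _ _ Gx Gy); rewrite /= rmorph1 scale1r mul1r.
  move=> /le_trans; apply; rewrite [leRHS]addrC.
  apply: le_trans (pD _ _).
  by rewrite addrACA [- v + v]addrC subrr addr0.
have Bsup : has_sup B.
  split; first by exists (0 - p (0 - v)), (0, 0).
  by exists (p (0 + v) - 0) => _ [x Gx <-]; exact: key G0.
pose c := sup B.
have lec x : G x -> x.2 - p (x.1 - v) <= c.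
  by move=> Gx; apply: ub_le_sup; [case: Bsup|exists x].
have cle x : G x -> c <= p (x.1 + v) - x.2.
  move=> Gx; apply: ge_sup; first by case: Bsup.
  by move=> _ [y Gy <-]; exact: key.
exists [set z | exists2 x, G x & exists t, z = (x.1 + i t *: v, x.2 + t * c)].
  split; first split.
  - by exists (0, 0) => //; exists 0; rewrite rmorph0 scale0r mul0r !addr0.
  - move=> r _ _ [x Gx [t ->]] [y Gy [u ->]].
    exists (i r *: x.1 + y.1, r * x.2 + y.2); first exact: Glin.
    exists (r * t + u) => /=; congr pair; last by ring.
    by rewrite scalerDr scalerA -rmorphM rmorphD scalerDl addrACA.
  - move=> _ [x Gx [t ->]] /=.
    have [t0|t0|->] := ltrgt0P t; last first.
    + by rewrite rmorph0 scale0r mul0r !addr0; exact: Gdom.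
    + have s0 : 0 < - t by rewrite oppr_gt0.
      have := lec _ (GZ (- t)^-1 _ Gx); rewrite /= => H.
      have -> : x.1 + i t *: v = i (- t) *: (i (- t)^-1 *: x.1 - v).
        rewrite scalerBr scalerA -rmorphM mulfV ?gt_eqF// rmorph1 scale1r.
        by rewrite rmorphN scaleNr opprK.
      rewrite pZ ?(ltW s0) ?(ltW t0)//; rewrite -(ler_pM2l s0) mulrBr mulrA mulfV ?gt_eqF// mul1r in H.
      by move: H; lra.
    + have := cle _ (GZ t^-1 _ Gx); rewrite /= => H.
      have -> : x.1 + i t *: v = i t *: (i t^-1 *: x.1 + v).
        by rewrite scalerDr scalerA -rmorphM mulfV ?gt_eqF// rmorph1 scale1r.
      rewrite pZ ?(ltW s0) ?(ltW t0)//; rewrite -(ler_pM2l t0) mulrBr mulrA mulfV ?gt_eqF// mul1r in H.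
      by move: H; lra.
split; first by move=> x Gx; exists x => //; exists 0; rewrite rmorph0 scale0r mul0r !addr0 -surjective_pairing.
move=> /(_ (v, c)) H; apply: (Gv c); apply: H.
by exists (0, 0) => //; exists 1; rewrite rmorph1 scale1r mul1r !add0r.
Qed.

(** The functional to be extended and its extensions are handled as graphs, so
    that extension is inclusion and Zorn's lemma applies to unions of chains. *)
Lemma real_hahn_banach (G : set (V * R)) : real_linear_graph G ->
  (forall x, G x -> x.2 <= p x.1) ->
  exists g : V -> R, [/\ forall r v w, g (i r *: v + w) = r * g v + g w,
    forall v, g v <= p v & forall x, G x -> g x.1 = x.2].
Proof.
move=> Glin Gdom; have goodG : good G by [].
have [F Fgood chF|M [Mgood maxM]] :=
    @Zorn_bigcup _ [set A | A = set0 \/ good A /\ G `<=` A].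
  have [[A FA A0]|F0] := pselect (exists2 A, F A & A <> set0); last first.
    left; apply: bigcup0 => X FX; apply: contrapT => X0.
    by apply: F0; exists X.
  have goodF X x : F X -> X x -> good X.
    by move=> FX Xx; case: (Fgood _ FX) => [X0|[]//]; rewrite X0 in Xx.
  have GA : G `<=` A by case: (Fgood _ FA) => [/A0//|[]//].
  right; split; last by move=> x /GA; exists A.
  split; last by move=> x [X FX Xx]; have [_] := goodF _ _ FX Xx; exact.
  split; first by exists A => //; apply: GA; case: Glin.
  move=> r x y [X FX Xx] [X' FX' X'y].
  have [XX'|X'X] := chF _ _ FX FX'.
    by exists X' => //; apply: (goodF _ _ FX' X'y).1.2 => //; exact: XX'.
  by exists X => //; apply: (goodF _ _ FX Xx).1.2 => //=; exact: X'X.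
have {Mgood}[goodM GM] : good M /\ G `<=` M.
  case: Mgood => // M0; exfalso; apply: (maxM G); last by right; split.
  by rewrite M0; split=> [x //|GM]; exact: GM _ Glin.1.
have tot v : exists a, M (v, a).
  apply: contrapT => /forallNP /(good_extend goodM)[M' goodM' MM'].
  apply: (maxM _ MM'); right; split=> //; apply: subset_trans GM _; exact: MM'.1.
have [g gM] := choice tot.
exists g; split.
- move=> r v w; apply: (good_unique goodM (gM _)).
  by have := goodM.1.2 r _ _ (gM v) (gM w).
- by move=> v; have := goodM.2 _ (gM v).
- by move=> [v a] /GM; exact: (good_unique goodM (gM v)).
Qed.
End real_hahn_banach.

Section hahn_banach.
Variables (R : realType) (K : numFieldType) (re : K -> R).

(** The real theorem extends the real part [g]; over the complex numbers,
    [v |-> g v - i g (i v)] is the complex-linear functional with real part [g],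
    and it is dominated by the norm because some unimodular multiple [u v] of
    [v] has a real nonnegative value. *)
Lemma hahn_banach (hK : real_or_complex re) (V : normedModType K)
    (G : V -> K -> Prop) :
  G 0 0 ->
  (forall c v w a b, G v a -> G w b -> G (c *: v + w) (c * a + b)) ->
  (forall v a, G v a -> rnorm re (a : K^o) <= rnorm re v) ->
  exists f : V -> K^o, [/\ linear f, forall v, rnorm re (f v) <= rnorm re v &
    forall v a, G v a -> f v = a].
Proof.
move=> G0 Glin Gdom.
have [S] := scalars_exist hK.
have re_rnorm (a : K) : re a <= rnorm re (a : K^o).
  case: hK a => [a|a]; first exact: ler_norm.
  have := normc_ge_Re a; rewrite /rnorm lecE => /andP[_]; apply: le_trans.
  exact: ler_norm.
have [|||g [glin gle gG]] := @real_hahn_banach R K (emb S) V (@rnorm _ _ re V)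
    (@rnormD _ _ _ S V) _ [set x | exists2 a, G x.1 a & x.2 = re a].
- by move=> r v r0; rewrite (rnormZ S) (rnorm_emb S).
- split; first by exists 0 => //=; rewrite (re0 S).
  move=> r x y [a Ga ->] [b Gb ->]; exists (emb S r * a + b); first exact: Glin.
  by rewrite (reD S) (reM S).
- by move=> x [a Ga ->]; apply: le_trans (re_rnorm a) _; exact: Gdom.
move: S {re_rnorm} glin gle gG; case: hK V G G0 Glin Gdom g.
- move=> V G G0 Glin Gdom g S glin gle gG.
  have embE r : emb S r = r by exact: (re_emb S).
  have g0 : g 0 = 0.
    by have := glin (-1) 0 0; rewrite !scaler0 addr0 mulN1r addNr.
  exists g; split.
  + by move=> r v w; have := glin r v w; rewrite embE.
  + move=> v; rewrite {1}/rnorm ler_norml gle andbT lerNl.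
    have <- : g (- v) = - g v.
      by have := glin (-1) v 0; rewrite !embE scaleN1r !addr0 mulN1r g0 addr0.
    by rewrite -(rnormN id v); exact: gle.
  + by move=> v a Gva; apply: gG (v, a) _; exists a.
- move=> V G G0 Glin Gdom g S glin gle gG.
  have embE r : emb S r = r%:C%C.
    wlog r0 : r / 0 <= r.
      move=> H; have [/H//|r0] := leP 0 r.
      by rewrite -[r]opprK rmorphN H ?oppr_ge0 1?ltW// [in RHS]rmorphN.
    have := r0; rewrite -(emb_ge0 S) => /ger0_real/RRe_real <-.
    by rewrite (re_emb S).
  have g0 : g 0 = 0.
    by have := glin (-1) 0 0; rewrite !scaler0 addr0 mulN1r addNr.
  have gD v w : g (v + w) = g v + g w.
    by have := glin 1 v w; rewrite rmorph1 scale1r mul1r.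
  have gZ r v : g (r%:C%C *: v) = r * g v.
    by have := glin r v 0; rewrite embE !addr0 g0 addr0.
  pose f v : R[i] := (g v -i* g ('i%C *: v))%C.
  have flin : linear (f : V -> R[i]^o).
    move=> [a b] v w; rewrite /f.
    have -> : (a +i* b)%C = a%:C%C + b%:C%C * 'i%C :> R[i].
      by apply/eqP; rewrite eq_complex /=; apply/andP; split; apply/eqP; ring.
    rewrite !(scalerDl, scalerDr) !gD -!scalerA !gZ.
    have -> : 'i%C *: (a%:C%C *: v) = a%:C%C *: ('i%C *: v).
      by rewrite !scalerA mulrC.
    have -> : 'i%C *: (b%:C%C *: ('i%C *: v)) = - (b%:C%C *: v).
      rewrite !scalerA -scaleNr; congr (_ *: _).
      by apply/eqP; rewrite eq_complex /=; apply/andP; split; apply/eqP; ring.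
    have gN u : g (- u) = - g u.
      by have := gD u (- u); rewrite subrr g0; lra.
    rewrite gN !gZ; apply/eqP; rewrite eq_complex /=.
    by apply/andP; split; apply/eqP; ring.
  exists f; split => //.
  + move=> v; have [->|fv0] := eqVneq (f v) 0.
      by rewrite (rnorm0 S) (rnorm_ge0 S).
    (* a unimodular scalar that rotates [f v] to its modulus *)
    pose u : R[i] := `|f v| / f v.
    have fu : f (u *: v) = `|f v|.
      have := flin u v 0; rewrite addr0 => ->.
      have -> : f 0 = 0 by rewrite /f scaler0 g0 oppr0.
      by rewrite addr0 /u; rewrite /GRing.scale /= divfK.
    have -> : rnorm (@complex.Re R) (f v : R[i]^o) = g (u *: v).
      by rewrite /rnorm -fu.
    apply: le_trans (gle _) _; rewrite (rnormZ S).
    have -> : rnorm (@complex.Re R) (u : R[i]^o) = 1.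
      rewrite /rnorm /u normrM normfV normr_id divff ?normr_eq0//.
    by rewrite mul1r.
  + move=> v a Gva; have := gG (v, complex.Re a) (ex_intro2 _ _ _ Gva erefl).
    have Giv : G ('i%C *: v) ('i%C * a).
      by have := Glin 'i%C v 0 a 0 Gva G0; rewrite !addr0.
    have := gG (_, _) (ex_intro2 _ _ _ Giv erefl).
    rewrite /f /= => -> ->; case: a {Gva Giv} => a b /=.
    by apply/eqP; rewrite eq_complex /=; apply/andP; split; apply/eqP; ring.
Qed.

End hahn_banach.

(** * Linear functionals on infinite-dimensional spaces *)

Section functionals.
Variables (R : realType) (K : numFieldType) (re : K -> R).
Hypothesis hK : real_or_complex re.
Variable S : scalars re.
Variable Y : normedModType K.
Local Notation N := (rnorm re).

Definition bounded_functional (f : Y -> K^o) : Prop :=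
  linear f /\ exists C, forall y, N (f y) <= C * N y.

Lemma linear_fun0 (W : lmodType K) (f : Y -> W) : linear f -> f 0 = 0.
Proof.
move=> lf; have := lf (-1) 0 0.
by rewrite scaler0 addr0 scaleN1r addNr.
Qed.

Lemma linear_funZ (W : lmodType K) (f : Y -> W) c y : linear f -> f (c *: y) = c *: f y.
Proof. by move=> lf; have := lf c y 0; rewrite (linear_fun0 lf) !addr0. Qed.

Lemma linear_fun_sum (W : lmodType K) (f : Y -> W) (I : Type) (s : seq I) (P : pred I)
    (c : I -> K) (y : I -> Y) : linear f ->
  f (\sum_(j <- s | P j) c j *: y j) = \sum_(j <- s | P j) c j *: f (y j).
Proof.
move=> lf; elim/big_rec2: _ => [|j u v _ <-]; first exact: linear_fun0.
exact: lf.
Qed.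

Lemma norming_functional (x : Y) : x != 0 ->
  exists f : Y -> K^o, [/\ linear f, forall y, N (f y) <= N y & f x = emb S (N x)].
Proof.
move=> x0.
have [|||f [flin fN fx]] := @hahn_banach _ _ _ hK Y
    (fun v a => exists2 c, v = c *: x & a = c * emb S (N x)).
- by exists 0; rewrite ?scale0r ?mul0r.
- move=> c _ _ _ _ [a -> ->] [b -> ->]; exists (c * a + b).
    by rewrite scalerA scalerDl.
  by rewrite mulrA mulrDl.
- move=> _ _ [c -> ->]; rewrite !(rnormZ S) (rnorm_emb S)//.
  exact: (rnorm_ge0 S).
- exists f; split => //; apply: fx; exists 1; by rewrite ?scale1r ?mul1r.
Qed.

Lemma bounded_functionalD f c g : bounded_functional f -> bounded_functional g ->
  bounded_functional (fun y => f y + c *: g y).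
Proof.
move=> [lf [C fC]] [lg [D gD]]; split.
  by move=> a u v; rewrite lf lg /GRing.scale /=; ring.
exists (C + N (c : K^o) * D) => y; apply: le_trans (rnormD S _ _) _.
rewrite mulrDl; apply: lerD; first exact: fC.
by rewrite (rnormZ S) -mulrA ler_wpM2l ?(rnorm_ge0 S)//; exact: gD.
Qed.

Lemma bounded_functional_sum m (c : 'I_m -> K) (f : 'I_m -> Y -> K^o) :
  (forall i, bounded_functional (f i)) ->
  bounded_functional (fun y => \sum_(i < m) c i *: f i y).
Proof.
elim: m c f => [|m IH] c f bf.
  split; first by move=> a u v; rewrite !big_ord0 scaler0 addr0.
  by exists 0 => y; rewrite big_ord0 (rnorm0 S) mul0r.
have := bounded_functionalD (c ord_max)
  (IH (fun i => c (widen_ord (leqnSn m) i)) (fun i => f (widen_ord (leqnSn m) i))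
     (fun i => bf _)) (bf ord_max).
by congr bounded_functional; apply/funext => y; rewrite [RHS]big_ord_recr.
Qed.

Hypothesis infY : infinite_dimensional Y.

(** One direction at a time: a vector outside the span of the system is first
    made to vanish under the functionals already found. *)
Lemma biorthogonal_system m : exists (x : nat -> Y) (g : nat -> Y -> K^o),
  (forall a, (a < m)%N -> bounded_functional (g a)) /\
  (forall a b, (a < m)%N -> (b < m)%N -> g a (x b) = (a == b)%:R).
Proof.
elim: m => [|m [x [g [gb gx]]]].
  by exists (fun=> 0), (fun _ _ => 0); split.
have [v vx] : exists v, forall c : 'I_m -> K, v <> \sum_(i < m) c i *: x i.
  apply: contrapT => H; apply: infY; exists m, (fun i => x i) => v.
  apply: contrapT => /forallNP H'; apply: H; exists v => c; exact: H'.
pose x' := v - \sum_(i < m) g i v *: x i.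
have x'0 : x' != 0.
  by rewrite subr_eq0; apply/eqP; exact: vx.
have gx' a : (a < m)%N -> g a x' = 0.
  move=> am; have lg := (gb _ am).1.
  rewrite /x' addrC -scaleN1r lg linear_fun_sum// (bigD1 (Ordinal am))//= gx// eqxx.
  rewrite big1 ?addr0 => [|j ja].
    by rewrite /GRing.scale /= mulr1 mulN1r addNr.
  by rewrite gx// -val_eqE/= in ja *; rewrite eq_sym (negbTE ja) scaler0.
have [h [lh hN hx']] := norming_functional x'0.
have Nx' : emb S (N x') != 0.
  by rewrite (emb_rnorm S) normr_eq0.
pose h1 y : K^o := (emb S (N x'))^-1 *: h y.
have h1b : bounded_functional h1.
  split; first by move=> a u w; rewrite /h1 lh scalerDr !scalerA [_ * a]mulrC.
  exists (N ((emb S (N x'))^-1 : K^o)) => y.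
  by rewrite /h1 (rnormZ S) ler_wpM2l ?(rnorm_ge0 S).
have h1x : h1 x' = 1 by rewrite /h1 hx' [LHS]mulVf.
pose h2 y : K^o := h1 y + (-1) *: \sum_(i < m) h1 (x i) *: g i y.
have h2b : bounded_functional h2.
  by apply: bounded_functionalD => //; apply: bounded_functional_sum => i; exact: gb.
exists (fun b => if b == m then x' else x b), (fun a => if a == m then h2 else g a).
split=> [a|a b].
  by rewrite ltnS leq_eqVlt; case: eqP => // _ /= /gb.
rewrite !ltnS [(a <= m)%N]leq_eqVlt [(b <= m)%N]leq_eqVlt.
case: eqP => [->|/eqP am] /= Ha; case: eqP => [->|/eqP bm] /= Hb.
- rewrite eqxx /h2 h1x big1 ?scaler0 ?addr0// => j _.
  by rewrite gx' ?scaler0.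
- rewrite /h2 [_ == b]eq_sym (negbTE bm) (bigD1 (Ordinal Hb))//= gx// eqxx.
  rewrite big1 ?addr0 => [|j jb].
    by rewrite scaleN1r [_ *: _]mulr1 subrr.
  by rewrite gx// -val_eqE/= in jb *; rewrite (negbTE jb) scaler0.
- by rewrite gx' // (negbTE am).
- exact: gx.
Qed.

Lemma underdetermined_system r (A : 'M[K]_(r.+1, r)) :
  exists2 c : 'rV[K]_r.+1, c *m A = 0 & exists b, c 0 b != 0.
Proof.
have : kermx A != 0.
  by rewrite -mxrank_eq0 mxrank_ker subn_eq0 -ltnNge ltnS rank_leq_col.
move=> /rowV0Pn[c /sub_kermxP cA c0]; exists c => //.
apply: contrapT => /forallNP H; move/eqP: c0; apply; apply/rowP => b.
by rewrite mxE; apply/eqP; apply: contrapT => /negP; exact: H.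
Qed.

(** [r] functionals impose [r] linear conditions on the combinations of [r + 1]
    independent vectors. *)
Lemma unit_vector_in_common_kernel r (F : 'I_r -> Y -> K^o) :
  (forall j, linear (F j)) -> exists2 z, N z = 1 & forall j, F j z = 0.
Proof.
move=> lF; have [x [g [gb gx]]] := biorthogonal_system r.+1.
have [c cA [b cb]] := underdetermined_system (\matrix_(a, j) F j (x a)).
pose z := \sum_(a < r.+1) c 0 a *: x a.
have Fz j : F j z = 0.
  rewrite /z linear_fun_sum//; have := congr1 (fun M : 'rV_r => M 0 j) cA.
  rewrite !mxE => cA'; rewrite -[RHS]cA'.
  by apply: eq_bigr => a _; rewrite mxE.
have z0 : z != 0.
  apply: contraNneq cb => z0; have [lg _] := gb b (ltn_ord b).
  have := linear_fun_sum (index_enum _) xpredT (c 0) (fun a => x a) lg.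
  rewrite -/z z0 (linear_fun0 lg) (bigD1 b)//= gx// eqxx big1 ?addr0 => [|a ab].
    by move=> ->; rewrite [_ *: _]mulr1.
  by rewrite gx// -val_eqE/= in ab *; rewrite eq_sym (negbTE ab) scaler0.
have Nz : N z != 0 by apply: contra_neq z0; exact: (rnorm_eq0 S).
exists (emb S (N z)^-1 *: z) => [|j].
  by rewrite (rnormZ S) (rnorm_emb S) ?invr_ge0 ?(rnorm_ge0 S)// mulVf.
by rewrite linear_funZ// Fz scaler0.
Qed.

(** Dually, some nonzero combination of [r + 1] independent bounded functionals
    vanishes at [r] given points; it is rescaled to have norm 1. *)
Lemma unit_functional_vanishing_on r (p : 'I_r -> Y) :
  exists h : Y -> K^o, [/\ linear h, forall y, N (h y) <= N y,
    forall j, h (p j) = 0 & exists2 z, N z <= 1 & 2^-1 <= N (h z)].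
Proof.
have [x [g [gb gx]]] := biorthogonal_system r.+1.
have [c cA [b cb]] := underdetermined_system (\matrix_(a, j) g a (p j)).
pose h y : K^o := \sum_(a < r.+1) c 0 a *: g a y.
have [lh [C hC]] : bounded_functional h.
  by apply: bounded_functional_sum => a; exact: gb.
have hp j : h (p j) = 0.
  have := congr1 (fun M : 'rV_r => M 0 j) cA.
  rewrite !mxE => cA'; rewrite -[RHS]cA'.
  by apply: eq_bigr => a _; rewrite mxE.
have hx : h (x b) = c 0 b.
  rewrite /h (bigD1 b)//= gx// eqxx big1 ?addr0 => [|a ab].
    by rewrite [LHS]mulr1.
  by rewrite gx// -val_eqE/= in ab *; rewrite (negbTE ab) scaler0.
pose A := [set N (h y) | y in [set y | N y <= 1]].
have A0 : A 0 by exists 0; rewrite /= ?(linear_fun0 lh) ?(rnorm0 S).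
have Asup : has_sup A.
  split; first by exists 0.
  exists `|C| => _ [y /= y1 <-]; apply: le_trans (hC y) _.
  apply: le_trans (ler_norm _) _; rewrite normrM ler_piMr// ger0_norm//.
  exact: (rnorm_ge0 S).
have hA y : N (h y) <= sup A * N y.
  have [->|y0] := eqVneq y 0; first by rewrite (linear_fun0 lh) !(rnorm0 S) mulr0.
  have Ny : 0 < N y.
    rewrite lt_neqAle (rnorm_ge0 S) andbT eq_sym.
    by apply: contra_neq y0; exact: (rnorm_eq0 S).
  rewrite -ler_pdivrMr//; apply: ub_le_sup; first by case: Asup.
  exists (emb S (N y)^-1 *: y) => /=.
    by rewrite (rnormZ S) (rnorm_emb S) ?invr_ge0 ?(ltW Ny)// mulVf ?gt_eqF.
  by rewrite linear_funZ// (rnormZ S) (rnorm_emb S) ?invr_ge0 ?(ltW Ny)// mulrC.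
have As : 0 < sup A.
  have Nhx : 0 < N (h (x b)).
    rewrite lt_neqAle (rnorm_ge0 S) andbT eq_sym hx.
    by apply: contra_neq cb => /(rnorm_eq0 S).
  have := lt_le_trans Nhx (hA (x b)).
  rewrite ltNge; apply: contraNT; rewrite -leNgt => As.
  by rewrite mulr_le0_ge0 ?(rnorm_ge0 S).
exists (fun y => emb S (sup A)^-1 *: h y); split.
- by move=> a u v; rewrite lh scalerDr !scalerA [_ * a]mulrC.
- move=> y; rewrite (rnormZ S) (rnorm_emb S) ?invr_ge0 ?(ltW As)//.
  by rewrite mulrC ler_pdivrMr// mulrC.
- by move=> j; rewrite hp scaler0.
have As2 : 0 < sup A / 2 by rewrite divr_gt0.
have [_ [z /= z1 <-] hz] := sup_adherent As2 Asup.
exists z => //; rewrite (rnormZ S) (rnorm_emb S) ?invr_ge0 ?(ltW As)//.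
rewrite mulrC ler_pdivlMr//; apply: ltW; apply: le_lt_trans hz.
by rewrite le_eqVlt; apply/orP; left; apply/eqP; field.
Qed.

End functionals.

(** * A Dvoretzky-Rogers lemma for functionals *)

(** The matrix of blocks [1, A; B, 1] has two factorisations into triangular
    blocks. *)
Lemma sylvester_det (F : comNzRingType) m k (A : 'M[F]_(m, k)) (B : 'M[F]_(k, m)) :
  \det (1%:M - A *m B) = \det (1%:M - B *m A).
Proof.
have E1 : block_mx 1%:M A B 1%:M =
    block_mx 1%:M 0 B 1%:M *m block_mx 1%:M A 0 (1%:M - B *m A).
  rewrite mulmx_block !(mul1mx, mul0mx, mulmx0, mulmx1, addr0).
  by rewrite addrC subrK.
have E2 : block_mx 1%:M A B 1%:M =
    block_mx (1%:M - A *m B) A 0 1%:M *m block_mx 1%:M 0 B 1%:M.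
  rewrite mulmx_block !(mul1mx, mul0mx, mulmx0, mulmx1, add0r).
  by rewrite subrK.
have := congr1 determinant E1; rewrite {1}E2 !det_mulmx !det_lblock !det_ublock.
by rewrite !det1 !mul1r !mulr1.
Qed.

Section hermitian_products.
Variables (R : realType) (K : numFieldType) (re : K -> R).
Variable S : scalars re.
Local Notation N := (rnorm re).

Definition adjoint m k (M : 'M[K]_(m, k)) : 'M[K]_(k, m) := (map_mx (cj S) M)^T.

Definition norm_sq m (u : 'cV[K]_m) : R := \sum_(j < m) N (u j 0 : K^o) ^+ 2.

Definition inner_product m (u v : 'cV[K]_m) : K := (adjoint u *m v) 0 0.

Lemma adjM m k l (A : 'M[K]_(m, k)) (B : 'M[K]_(k, l)) :
  adjoint (A *m B) = adjoint B *m adjoint A.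
Proof. by rewrite /adjoint map_mxM trmx_mul. Qed.

Lemma adjK m k (A : 'M[K]_(m, k)) : adjoint (adjoint A) = A.
Proof. by apply/matrixP => a b; rewrite !mxE (cjK S). Qed.

Lemma adjB m k (A B : 'M[K]_(m, k)) : adjoint (A - B) = adjoint A - adjoint B.
Proof. by apply/matrixP => a b; rewrite !mxE rmorphB. Qed.

Lemma inner_productE m (u : 'cV[K]_m) : inner_product u u = emb S (norm_sq u).
Proof.
rewrite /inner_product mxE rmorph_sum; apply: eq_bigr => j _.
by rewrite !mxE mulrC (mul_cj S).
Qed.

Lemma norm_sq_ge0 m (u : 'cV[K]_m) : 0 <= norm_sq u.
Proof. by apply: sumr_ge0 => j _; rewrite sqr_ge0. Qed.

Lemma norm_sqZ m c (u : 'cV[K]_m) : norm_sq (c *: u) = N (c : K^o) ^+ 2 * norm_sq u.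
Proof.
rewrite /norm_sq mulr_sumr; apply: eq_bigr => j _.
by rewrite mxE (rnormM S) exprMn.
Qed.

Lemma emb_inj : injective (emb S).
Proof. by move=> r s /(congr1 re); rewrite !(re_emb S). Qed.

Section orthonormal.
Variables (m k : nat) (E : 'M[K]_(m, k)).
Hypothesis E1 : adjoint E *m E = 1%:M.

Let Q := E *m adjoint E.

Lemma adj_proj : adjoint Q = Q. Proof. by rewrite /Q adjM adjK. Qed.

Lemma proj_proj : Q *m Q = Q.
Proof. by rewrite /Q mulmxA -(mulmxA E) E1 mulmx1. Qed.

Lemma inner_proj u : (adjoint u *m Q *m u) 0 0 = emb S (norm_sq (adjoint E *m u)).
Proof. by rewrite -inner_productE /inner_product adjM adjK /Q !mulmxA. Qed.

Lemma norm_sq_stretch u :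
  norm_sq ((2%:M - Q) *m u) = 4 * norm_sq u - 3 * norm_sq (adjoint E *m u).
Proof.
apply: emb_inj; rewrite -inner_productE /inner_product adjM mulmxA -(mulmxA (adjoint u)).
have -> : adjoint (2%:M - Q) *m (2%:M - Q) = 4%:M - 3 *: Q.
  rewrite adjB adj_proj.
  have -> : adjoint (2%:M : 'M[K]_m) = 2%:M.
    by rewrite /adjoint map_scalar_mx rmorph_nat tr_scalar_mx.
  rewrite mulmxBl !mulmxBr proj_proj !mul_scalar_mx !mul_mx_scalar.
  rewrite scale_scalar_mx -natrM.
  apply/matrixP => a b; rewrite !mxE; ring.
rewrite mulmxBr mulmxBl mxE [in X in _ + X]mxE -scalemxAr -scalemxAl [in X in _ - X]mxE.
rewrite inner_proj mul_mx_scalar -scalemxAl mxE.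
by rewrite -/(inner_product u u) inner_productE rmorphB !rmorphM !rmorph_nat.
Qed.

Lemma norm_sq_residual u : norm_sq (u - Q *m u) = norm_sq u - norm_sq (adjoint E *m u).
Proof.
apply: emb_inj; rewrite -inner_productE /inner_product.
have -> : u - Q *m u = (1%:M - Q) *m u by rewrite mulmxBl mul1mx.
rewrite adjM mulmxA -(mulmxA (adjoint u)).
have -> : adjoint (1%:M - Q) *m (1%:M - Q) = 1%:M - Q.
  rewrite adjB adj_proj.
  have -> : adjoint (1%:M : 'M[K]_m) = 1%:M.
    by rewrite /adjoint map_mx1 trmx1.
  by rewrite mulmxBl !mulmxBr proj_proj !mul1mx !mulmx1 subrr subr0.
rewrite mulmxBr mulmx1 mulmxBl mxE [in X in _ + X]mxE inner_proj -/(inner_product u u) inner_productE.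
by rewrite rmorphB.
Qed.

(** The map that doubles the orthogonal complement of [k] orthonormal vectors
    and fixes their span. *)
Lemma det_stretch : \det (2%:M - Q) * 2 ^+ k = 2 ^+ m.
Proof.
have -> : 2%:M - Q = (2 : K) *: (1%:M - (2^-1 *: E) *m adjoint E).
  by rewrite scalerBr -scalemxAl scalerA mulfV ?pnatr_eq0// scale1r scale_scalar_mx mulr1.
rewrite detZ sylvester_det -scalemxAr E1 -[1%:M in X in X - _]scale1r -scalerBl.
rewrite detZ det1 mulr1 -mulrA -exprMn.
have -> : (1 - 2^-1) * 2 = 1 :> K by rewrite mulrBl mulVf ?pnatr_eq0//; ring.
by rewrite expr1n mulr1.
Qed.

End orthonormal.
End hermitian_products.

Section near_maximal_volume.
Variables (R : realType) (K : numFieldType) (re : K -> R).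
Hypothesis hK : real_or_complex re.
Variable S : scalars re.
Variable Y : normedModType K.
Hypothesis infY : infinite_dimensional Y.
Local Notation N := (rnorm re).
Local Notation inner := (inner_product S).
Local Notation adj := (adjoint S).
Local Notation normsq := (norm_sq re).

Section maximal_volume.
Variables (m : nat) (x : nat -> Y).

Definition contractive (T : Y -> 'cV[K]_m) : Prop :=
  linear T /\ forall y, normsq (T y) <= N y ^+ 2.

(** Maximising its modulus minimises the volume of the ellipsoid
    [norm_sq (T y) <= 1] on the span of the [x j], which contains the unit ball
    of that span when [T] is contractive. *)
Definition volume (T : Y -> 'cV[K]_m) : K :=
  \det (\matrix_(i < m, j < m) T (x j) i 0).

Lemma volumeM (A : 'M[K]_m) T : volume (fun y => A *m T y) = \det A * volume T.
Proof.
rewrite -det_mulmx; congr (\det _); apply/matrixP => i j.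
by rewrite !mxE; apply: eq_bigr => l _; rewrite mxE.
Qed.

Lemma volume_bound T : contractive T ->
  N (volume T : K^o) <= \sum_(s : 'S_m) \prod_(i < m) N (x (s i)).
Proof.
move=> [_ cT]; apply: le_trans (rnorm_sum S _ _ _) _; apply: ler_sum => s _.
rewrite (rnormM S) (rnorm_prod S).
have -> : N ((-1) ^+ s : K^o) = 1.
  by rewrite /rnorm normrX normrN1 expr1n (re1 S).
rewrite mul1r; apply: ler_prod => i _; rewrite (rnorm_ge0 S) mxE /=.
rewrite -(ler_pXn2r (n := 2)) ?nnegrE ?(rnorm_ge0 S)//.
apply: le_trans (cT _); rewrite /norm_sq (bigD1 i)//= lerDl.
by apply: sumr_ge0 => j _; rewrite sqr_ge0.
Qed.

(** A maximum up to a factor 2 is enough below, which avoids any compactness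
    argument. *)
Lemma near_maximal_volume : (exists2 T, contractive T & volume T != 0) ->
  exists2 T, contractive T /\ 0 < N (volume T : K^o) &
    forall T', contractive T' -> N (volume T' : K^o) <= 2 * N (volume T : K^o).
Proof.
move=> [T0 cT0 vT0].
pose A := [set N (volume T : K^o) | T in contractive].
have Asup : has_sup A.
  split; first by exists (N (volume T0 : K^o)), T0.
  by exists (\sum_(s : 'S_m) \prod_(i < m) N (x (s i))) => _ [T /volume_bound ? <-].
have A0 : 0 < sup A.
  apply: (@lt_le_trans _ _ (N (volume T0 : K^o))); last first.
    by apply: ub_le_sup; [case: Asup|exists T0].
  rewrite lt_neqAle (rnorm_ge0 S) andbT eq_sym.
  by apply: contra_neq vT0 => /(rnorm_eq0 S).
have A2 : 0 < sup A / 2 by rewrite divr_gt0.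
have [_ [T cT <-] hT] := sup_adherent A2 Asup.
exists T; first by split => //; move: hT; lra.
move=> T' cT'; have : N (volume T' : K^o) <= sup A.
  by apply: ub_le_sup; [case: Asup|exists T'].
by move: hT; lra.
Qed.

End maximal_volume.

(** A small multiple of the map whose coordinates are the functionals of a
    biorthogonal system. *)
Lemma positive_volume m : (0 < m)%N -> exists x : nat -> Y,
  exists2 T, @contractive m T & volume x T != 0.
Proof.
move=> m0; have [x [g [gb gx]]] := biorthogonal_system hK S infY m.
have [C C1 hC] : exists2 C, 1 <= C & forall a y, (a < m)%N -> N (g a y) <= C * N y.
  elim: (m) gb => [|k IH] gb; first by exists 1.
  have [C C1 hC] : exists2 C, 1 <= C & forall a y, (a < k)%N -> N (g a y) <= C * N y.
    by apply: IH => a ak; apply: gb; exact: ltnW.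
  have [_ [D hD]] := gb k (ltnSn k).
  exists (C + `|D|) => [|a y]; first by have := normr_ge0 D; move: C1; lra.
  have Ny := rnorm_ge0 S y.
  rewrite ltnS leq_eqVlt mulrDl => /orP[/eqP->|ak].
    apply: le_trans (hD y) _; have := ler_norm (D * N y).
    rewrite normrM (ger0_norm Ny).
    have : 0 <= C * N y by rewrite mulr_ge0//; move: C1; lra.
    lra.
  apply: le_trans (hC _ _ ak) _; rewrite lerDl mulr_ge0//.
have mC : 0 < m%:R * C by rewrite mulr_gt0 ?ltr0n//; move: C1; lra.
pose eps := (m%:R * C)^-1.
have eps0 : 0 < eps by rewrite invr_gt0.
exists x, (fun y => \col_i (emb S eps * g i y)).
  split.
    move=> c u v; apply/colP => i; rewrite !mxE (gb i (ltn_ord i)).1 /GRing.scale /=.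
    by ring.
  move=> y; apply: le_trans (_ : \sum_(i < m) m%:R^-1 * N y ^+ 2 <= _).
    apply: ler_sum => i _; rewrite mxE (rnormM S) (rnorm_emb S) ?(ltW eps0)//.
    have -> : m%:R^-1 * N y ^+ 2 = m%:R * (eps * (C * N y)) ^+ 2.
      rewrite /eps; field; rewrite pnatr_eq0 -lt0n m0/= andbT.
      by apply/eqP => C0; move: C1; rewrite C0; lra.
    apply: le_trans (_ : (eps * (C * N y)) ^+ 2 <= _).
      rewrite ler_pXn2r ?nnegrE ?mulr_ge0 ?(rnorm_ge0 S) ?(ltW eps0)//.
      - rewrite ler_pM2l//; exact: hC.
      - by move: C1; lra.
    by rewrite ler_peMl ?sqr_ge0// ler1n.
  rewrite sumr_const card_ord -mulrnAl -mulr_natr mulVf ?mul1r//.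
  by rewrite pnatr_eq0 -lt0n.
rewrite /volume.
have -> : (\matrix_(i, j) (\col_i0 (emb S eps * g i0 (x j))) i 0) = (emb S eps)%:M :> 'M[K]_m.
  by apply/matrixP => i j; rewrite !mxE gx// -val_eqE /=; case: eqP; rewrite ?mulr1 ?mulr0.
by rewrite det_scalar expf_neq0// fmorph_eq0 gt_eqF.
Qed.

End near_maximal_volume.

Section dvoretzky_rogers.
Variables (R : realType) (K : numFieldType) (re : K -> R).
Hypothesis hK : real_or_complex re.
Variable S : scalars re.
Variable Y : normedModType K.
Hypothesis infY : infinite_dimensional Y.
Local Notation N := (rnorm re).
Local Notation inner := (inner_product S).
Local Notation adj := (adjoint S).
Local Notation normsq := (norm_sq re).

Lemma inner_linear m (u : 'cV[K]_m) : linear (inner u : 'cV[K]_m -> K^o).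
Proof.
by move=> c v w; rewrite /inner_product mulmxDr -scalemxAr mxE [in X in X + _]mxE.
Qed.

Lemma inner_sum m (u : 'cV[K]_m) k (c : nat -> K) (e : nat -> 'cV[K]_m) :
  inner u (\sum_(j < k) c j *: e j) = \sum_(j < k) c j * inner u (e j).
Proof.
rewrite /inner_product mulmx_sumr summxE; apply: eq_bigr => j _.
by rewrite -scalemxAr mxE.
Qed.

Lemma innerC m (u v : 'cV[K]_m) : inner u v = cj S (inner v u).
Proof.
rewrite /inner_product !mxE rmorph_sum; apply: eq_bigr => i _.
by rewrite !mxE rmorphM (cjK S) mulrC.
Qed.

Lemma norm_sq0 m : normsq (0 : 'cV[K]_m) = 0.
Proof. by rewrite /norm_sq big1// => j _; rewrite mxE (rnorm0 S) expr0n. Qed.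

(** If [T] were short on the orthogonal complement of the span of the columns of
    [E], then stretching this complement by 2 and shrinking everything by 3/4
    would give a contractive map again: [9/16 * (1 + 3 * 1/4) <= 1].  Its
    determinant would be that of [T] multiplied by
    [(3/4)^(2 n) * 2^(2 n - k) >= 2 * (9/8)^n > 2], against the
    near-maximality of [T]. *)
Lemma room_outside_subspace n k (x : nat -> Y) (T : Y -> 'cV[K]_(2 * n))
    (E : 'M[K]_(2 * n, k)) :
  (k < n)%N -> contractive re T -> 0 < N (volume x T : K^o) ->
  (forall T' : Y -> 'cV[K]_(2 * n), contractive re T' -> N (volume x T' : K^o) <= 2 * N (volume x T : K^o)) ->
  adj E *m E = 1%:M ->
  exists2 y, N y <= 1 & 4^-1 < normsq (T y) - normsq (adj E *m T y).
Proof.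
move=> kn [lT cT] vT maxT E1; apply: contrapT => H.
have {}H y : normsq (T y) - normsq (adj E *m T y) <= 4^-1 * N y ^+ 2.
  have [->|y0] := eqVneq y 0.
    by rewrite (linear_fun0 lT) mulmx0 !norm_sq0 subrr (rnorm0 S) expr0n mulr0.
  have Ny : 0 < N y.
    rewrite lt_neqAle (rnorm_ge0 S) andbT eq_sym.
    by apply: contra_neq y0; exact: (rnorm_eq0 S).
  rewrite leNgt; apply/negP => Hy; apply: H.
  exists (emb S (N y)^-1 *: y).
    by rewrite (rnormZ S) (rnorm_emb S) ?invr_ge0 ?(ltW Ny)// mulVf ?gt_eqF.
  rewrite linear_funZ// -scalemxAr !(norm_sqZ S) (rnorm_emb S) ?invr_ge0 ?(ltW Ny)//.
  by rewrite -mulrBr exprVn mulrC ltr_pdivlMr ?exprn_gt0.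
pose A := 2%:M - E *m adj E.
pose T' y := emb S (3 / 4) *: (A *m T y).
have cT' : contractive re T'.
  split; first by move=> c u v; rewrite /T' lT mulmxDr -scalemxAr scalerDr !scalerA [_ * c]mulrC.
  move=> y; rewrite /T' (norm_sqZ S) (rnorm_emb S); last by lra.
  rewrite norm_sq_stretch//; have := cT y; have := H y; have := sqr_ge0 (N y).
  move: (normsq _) (normsq _) (N y ^+ 2) => a b c; rewrite expr2; lra.
have := maxT _ cT'.
have -> : volume x T' = emb S (3 / 4) ^+ (2 * n) * (\det A * volume x T).
  rewrite -volumeM -detZ; congr (\det _); apply/matrixP => i j.
  by rewrite /T' !mxE.
rewrite !(rnormM S) mulrA ler_pM2r//.
have -> : N (emb S (3 / 4) ^+ (2 * n) : K^o) = (3 / 4) ^+ (2 * n).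
  by rewrite -rmorphXn (rnorm_emb S)// exprn_ge0//; lra.
have : N (\det A : K^o) * 2 ^+ k = 2 ^+ (2 * n).
  have := congr1 (fun z : K => N (z : K^o)) (det_stretch E1).
  rewrite (rnormM S) -!natrX /=.
  have NN p : N (p%:R : K^o) = p%:R.
    by rewrite -[p%:R](rmorph_nat (emb S)) (rnorm_emb S).
  by rewrite !NN.
have -> : 2 ^+ (2 * n) = (2 : R) ^+ (2 * n - k) * 2 ^+ k.
  rewrite -exprD subnK// mul2n -addnn; apply: leq_trans (ltnW kn) _; exact: leq_addl.
move=> /(mulIf _)->; last by rewrite expf_neq0.
apply/negP; rewrite -ltNge.
apply: lt_le_trans (_ : (3 / 4) ^+ (2 * n) * 2 ^+ n.+1 <= _); last first.
  rewrite ler_pM2l ?exprn_gt0//.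
  by rewrite ler_eXn2l ?ltr1n//; lia.
rewrite exprM [2 ^+ n.+1]exprS mulrCA -exprMn -[ltLHS]mulr1 ltr_pM2l//.
rewrite exprn_egt1; first by lia.
by rewrite expr2; lra.
Qed.

(** Greedy orthonormalisation: each new direction is found in the orthogonal
    complement of the previous ones, so that the functional attached to it
    annihilates the vectors chosen before. *)
Lemma dvoretzky_rogers n : exists (f : nat -> Y -> K^o) (v : nat -> Y),
  [/\ forall a, linear (f a), forall y, \sum_(a < n) N (f a y) ^+ 2 <= N y ^+ 2,
      forall a, (a < n)%N -> N (v a) <= 1,
      forall a, (a < n)%N -> f a (v a) = emb S 2^-1 &
      forall a b, (b < a < n)%N -> f a (v b) = 0].
Proof.
case: n => [|n'].
  exists (fun _ _ => 0), (fun=> 0); split => //; first by move=> a c u w; rewrite scaler0 addr0.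
  by move=> y; rewrite big_ord0 sqr_ge0.
set n := n'.+1.
have [x0 Hx0] := @positive_volume _ _ _ hK S _ infY (2 * n) isT.
have [T [cT vT] maxT] := near_maximal_volume S Hx0.
have [lT Tle] := cT.
pose mat k (e : nat -> 'cV[K]_(2 * n)) := \matrix_(i < 2 * n, j < k) e j i 0.
have mat1 k e : (forall a b, (a < k)%N -> (b < k)%N -> inner (e a) (e b) = (a == b)%:R) ->
    adj (mat k e) *m mat k e = 1%:M.
  move=> He; apply/matrixP => a b; rewrite mxE [RHS]mxE -val_eqE/= -He// /inner_product mxE.
  by apply: eq_bigr => l _; rewrite !mxE.
have adj_mat k e u a : (adj (mat k e) *m u) a 0 = inner (e a) u.
  by rewrite /inner_product !mxE; apply: eq_bigr => l _; rewrite !mxE.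
have mat_mul k e (w : 'cV_k) : mat k e *m w = \sum_(a < k) w a 0 *: e a.
  apply/colP => l; rewrite mxE summxE; apply: eq_bigr => a _.
  by rewrite !mxE mulrC.
have build k : (k <= n)%N -> exists (e : nat -> 'cV[K]_(2 * n)) (v : nat -> Y),
    [/\ forall a b, (a < k)%N -> (b < k)%N -> inner (e a) (e b) = (a == b)%:R,
      forall a, (a < k)%N -> N (v a) <= 1,
      forall a, (a < k)%N -> inner (e a) (T (v a)) = emb S 2^-1 &
      forall b, (b < k)%N -> exists c : nat -> K, T (v b) = \sum_(j < b.+1) c j *: e j].
  elim: k => [|k IH] kn; first by exists (fun=> 0), (fun=> 0).
  have [e [v [e1 v1 ev Tv]]] := IH (ltnW kn).
  have [y y1 hy] := room_outside_subspace kn cT vT maxT (mat1 _ _ e1).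
  pose w := T y - mat k e *m adj (mat k e) *m T y.
  (* [w] is the part of [T y] orthogonal to the directions already chosen *)
  pose rho := Num.sqrt (normsq w).
  have nw : 4^-1 < normsq w by rewrite (norm_sq_residual (mat1 _ _ e1)).
  have rho2 : rho ^+ 2 = normsq w by rewrite sqr_sqrtr//; move: nw; lra.
  have rho_gt : 2^-1 < rho.
    rewrite -(ltr_pXn2r (n := 2)) ?nnegrE ?sqrtr_ge0// rho2.
    by apply: le_lt_trans nw; rewrite exprVn expr2; lra.
  have rho0 : 0 < rho by move: rho_gt; lra.
  have Erho : emb S rho != 0 by rewrite fmorph_eq0 gt_eqF.
  pose ek := emb S rho^-1 *: w.
  pose vk := emb S (2 * rho)^-1 *: y.
  have ew a : (a < k)%N -> inner (e a) w = 0.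
    move=> ak; rewrite -[a]/(nat_of_ord (Ordinal ak)) -adj_mat /w mulmxBr.
    by rewrite !mulmxA mat1// mul1mx subrr mxE.
  have we a : (a < k)%N -> inner w (e a) = 0.
    by move=> ak; rewrite innerC ew// rmorph0.
  have Ty : T y = emb S rho *: ek + \sum_(j < k) inner (e j) (T y) *: e j.
    rewrite /ek scalerA -rmorphM mulfV ?gt_eqF// rmorph1 scale1r.
    rewrite -[LHS](subrK (mat k e *m adj (mat k e) *m T y)) -/w; congr (_ + _).
    by rewrite -mulmxA mat_mul; apply: eq_bigr => j _; rewrite adj_mat.
  have iek u : inner ek u = emb S rho^-1 * inner w u.
    by rewrite /ek innerC (linear_funZ _ _ (inner_linear u)) rmorphM (cj_emb S) -innerC.
  have ewk : inner w ek = emb S rho.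
    rewrite /ek (linear_funZ _ _ (inner_linear w)) inner_productE -rho2 /GRing.scale /=.
    by rewrite -rmorphM; congr (emb S _); field; rewrite gt_eqF.
  have ekek : inner ek ek = 1.
    by rewrite iek ewk -rmorphM mulVf ?gt_eqF// rmorph1.
  have eek a : (a < k)%N -> inner (e a) ek = 0.
    by move=> ak; rewrite /ek (linear_funZ _ _ (inner_linear _)) ew// scaler0.
  have eke a : (a < k)%N -> inner ek (e a) = 0.
    by move=> ak; rewrite iek we// mulr0.
  have ekTy : inner ek (T y) = emb S rho.
    rewrite Ty inner_linear (inner_sum _ _ (fun j => inner (e j) (T y))) big1 ?addr0 => [|j _].
      by rewrite ekek [LHS]mulr1.
    by rewrite eke// mulr0.
  exists (fun a => if a == k then ek else e a), (fun a => if a == k then vk else v a).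
  split.
  - move=> a b; rewrite !ltnS [(a <= k)%N]leq_eqVlt [(b <= k)%N]leq_eqVlt.
    case: eqP => [->|/eqP ak] /= Ha; case: eqP => [->|/eqP bk] /= Hb.
    + by rewrite eqxx ekek.
    + by rewrite eke// eq_sym (negbTE bk).
    + by rewrite eek// (negbTE ak).
    + exact: e1.
  - move=> a; rewrite ltnS leq_eqVlt; case: eqP => [_ _|_ /=]; last exact: v1.
    rewrite /vk (rnormZ S) (rnorm_emb S) ?invr_ge0 ?mulr_ge0 ?(ltW rho0)//.
    rewrite mulrC ler_pdivrMr ?mulr_gt0//; apply: le_trans y1 _.
    by move: rho_gt; lra.
  - move=> a; rewrite ltnS leq_eqVlt; case: eqP => [_ _|_ /=]; last exact: ev.
    rewrite /vk (linear_funZ _ _ lT) (linear_funZ _ _ (inner_linear _)) ekTy.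
    by rewrite /GRing.scale /= -rmorphM; congr (emb S _); field; rewrite gt_eqF.
  - move=> b; rewrite ltnS leq_eqVlt; case: eqP => [-> _|_ /= bk]; last first.
      have [c ->] := Tv b bk; exists c; apply: eq_bigr => j _.
      by rewrite ltn_eqF//; apply: leq_trans bk; exact: ltn_ord.
    exists (fun j => emb S (2 * rho)^-1 * (if j == k then emb S rho else inner (e j) (T y))).
    rewrite /vk (linear_funZ _ _ lT) big_ord_recr /= !eqxx {1}Ty scalerDr scalerA addrC.
    congr (_ + _); rewrite scaler_sumr; apply: eq_bigr => j _.
    by rewrite ltn_eqF// scalerA.
have [e [v [e1 v1 ev Tv]]] := build n (leqnn n).
exists (fun a y => inner (e a) (T y)), v; split => //.
- by move=> a c u w; rewrite lT inner_linear.
- move=> y; apply: le_trans (Tle y).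
  have := norm_sq_ge0 re (T y - mat n e *m adj (mat n e) *m T y).
  rewrite (norm_sq_residual (mat1 _ _ e1)) subr_ge0; apply: le_trans.
  by apply: ler_sum => a _; rewrite adj_mat.
- move=> a b /andP[ba an]; have [c ->] := Tv b (ltn_trans ba an).
  rewrite inner_sum big1// => j _.
  have ja : (j < a)%N by apply: leq_trans ba; exact: ltn_ord.
  by rewrite e1 ?(ltn_trans ja an)// gtn_eqF// mulr0.
Qed.

End dvoretzky_rogers.

(** * Ordinal notations *)

Lemma olt_irr a : ~ olt a a.
Proof.
elim: a => [//|a IH|I h f IH] //; case=> k H; apply: (IH k).
apply: (@ole_trans (OSucc (OSup h f))) H.
exact: (@ole_sup I h f (f k) k (ole_refl _)).
Qed.

Lemma oltW a b : olt a b -> ole a b.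
Proof. exact: ole_trans (ole_succ a). Qed.

Lemma ole_lt_trans b a c : ole a b -> olt b c -> olt a c.
Proof. by move=> ab; apply: ole_trans. Qed.

Lemma olt_le_trans b a c : olt a b -> ole b c -> olt a c.
Proof. exact: ole_trans. Qed.

Lemma ole_addr a b : ole a (oadd a b).
Proof.
elim: b => [|b IH|I h f IH] /=; first exact: ole_refl.
  by apply: ole_trans IH _; exact: ole_succ.
have [k] := h; exact: (@ole_sup I _ (fun k => oadd a (f k)) a k).
Qed.

Lemma ole_add2l a b c : ole b c -> ole (oadd a b) (oadd a c).
Proof.
elim: b c => [|b IH|I h f IH] c /=; first by move=> _; exact: ole_addr.
- elim: c => [//|c _|J k g IHc] /=; first exact: IH.
  by case=> j /IHc H; exists j.
- by move=> H i; exact: IH (H i).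
Qed.

Lemma olt_add2l a b c : olt b c -> olt (oadd a b) (oadd a c).
Proof. exact: (@ole_add2l a (OSucc b)). Qed.

Lemma olt_add a b z : olt z (oadd a b) ->
  olt z a \/ exists2 c, olt c b & ole z (oadd a c).
Proof.
elim: b => [|b IH|I h f IH] /=; first by left.
  by move=> zab; right; exists b => //; exact: ole_refl.
move=> [i /IH[za|[c cb zc]]]; first by left.
by right; exists c => //; exact: (@ole_sup I h f (OSucc c) i cb).
Qed.

Lemma ole_mul_fin a m n : (m <= n)%N -> ole (omul a (ofin m)) (omul a (ofin n)).
Proof.
move=> /subnKC <-; elim: (n - m)%N => [|k IH]; first by rewrite addn0; exact: ole_refl.
by rewrite addnS; apply: ole_trans IH _; exact: ole_addr.
Qed.

(** * Words of digits and their ordinals *)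

(** A letter [(n, a)] stands for the index [a] in a system of [n] elements. *)
Definition digits := seq (nat * nat).

Definition valid (d : digits) : bool := all (fun p => p.2 < p.1)%N d.

(** Lexicographic order on the indices, with equal system sizes down to the
    first difference; below it, the sizes of the two words are unrelated. *)
Fixpoint dlt (d' d : digits) : bool :=
  match d', d with
  | p' :: r', p :: r =>
      (p'.1 == p.1) && ((p'.2 < p.2)%N || ((p'.2 == p.2) && dlt r' r))
  | _, _ => false
  end.

(** The Cantor normal form whose coefficients are the indices. *)
Fixpoint oval (d : digits) : tord :=
  if d is p :: r then oadd (omul (omega_pow (size r)) (ofin p.2)) (oval r)
  else OZero.

Lemma dlt_trans : transitive dlt.
Proof.
move=> d2 d1 d3; elim: d2 d1 d3 => [|p2 r2 IH] [|p1 r1] [|p3 r3] //=.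
move=> /andP[/eqP-> H12] /andP[/eqP-> H23]; rewrite eqxx /=.
case/orP: H12 => [H12|/andP[/eqP-> H12]]; case/orP: H23 => [H23|/andP[/eqP<- H23]].
- by rewrite (ltn_trans H12 H23).
- by rewrite H12.
- by rewrite H23.
- by rewrite eqxx (IH _ _ H12 H23) orbT.
Qed.

Lemma oval_lt_step (p : nat * nat) r : olt (oval r) (omega_pow (size r)) ->
  olt (oval (p :: r)) (omul (omega_pow (size r)) (ofin p.2.+1)).
Proof. exact: olt_add2l. Qed.

Lemma oval_lt d : olt (oval d) (omega_pow (size d)).
Proof.
elim: d => [//|p r IH] /=; exists p.2.+1; exact: oval_lt_step.
Qed.

Lemma dlt_oval d' d : size d' = size d -> dlt d' d -> olt (oval d') (oval d).
Proof.
elim: d' d => [|p' r' IH] [|p r] //=; case=> sz /andP[_ /orP[lt|/andP[/eqP-> /(IH _ sz) H]]].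
  apply: olt_le_trans (oval_lt_step _ (oval_lt r')) _.
  by rewrite sz; apply: ole_trans (ole_addr _ _); exact: ole_mul_fin.
by rewrite sz; exact: olt_add2l.
Qed.

(** Sizes are unconstrained when a new index is introduced, so words of the
    right length are cofinal below [omega^M]; the same induction on [a] serves
    for [omega^M * a]. *)
Lemma omega_pow_mul_cofinal M :
  (forall z, olt z (omega_pow M) -> exists d, [/\ valid d, size d = M & ole z (oval d)]) ->
  forall a z, olt z (omul (omega_pow M) (ofin a)) ->
  exists b r, [/\ (b < a)%N, valid r, size r = M &
    ole z (oadd (omul (omega_pow M) (ofin b)) (oval r))].
Proof.
move=> H; elim=> [//|a IH] z /olt_add[/IH[b [r [ba vr sr zr]]]|[c /H[r [vr sr cr]] zc]].
  by exists b, r; split => //; exact: ltnW.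
by exists a, r; split => //; apply: ole_trans zc _; exact: ole_add2l.
Qed.

Lemma omega_pow_cofinal M z : olt z (omega_pow M) ->
  exists d, [/\ valid d, size d = M & ole z (oval d)].
Proof.
elim: M z => [|M IH] z; first by move=> z1; exists [::]; split.
move=> [k /(omega_pow_mul_cofinal IH)[b [r [bk vr sr zr]]]].
by exists ((k, b) :: r); split => /=; rewrite ?bk ?sr.
Qed.

Lemma omega_pow_mul_cofinal_digits M n z : olt z (omul (omega_pow M) (ofin n)) ->
  exists d, [/\ valid d, size d = M.+1, (head (0, 0) d).1 = n & ole z (oval d)]%N.
Proof.
move=> /(omega_pow_mul_cofinal (@omega_pow_cofinal M))[b [r [bn vr sr zr]]].
by exists ((n, b) :: r); split => //=; rewrite ?bn ?sr.
Qed.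

(** An ordinal below the value of [d] is dominated by lowering one letter of [d]
    and choosing the following letters freely. *)
Lemma oval_cofinal d z : valid d -> olt z (oval d) ->
  exists d', [/\ valid d', size d' = size d, dlt d' d & ole z (oval d')].
Proof.
elim: d z => [//|[n a] r IH] z /= /andP[an vr].
move=> /olt_add[/(omega_pow_mul_cofinal (@omega_pow_cofinal _))|[c /(IH _ vr)]].
  move=> [b [r' [ba vr' sr' zr']]]; exists ((n, b) :: r').
  by split; rewrite /= ?eqxx ?ba ?sr'// (ltn_trans ba an).
move=> [r' [vr' sr' r'r cr']] zc; exists ((n, a) :: r').
split; rewrite /= ?eqxx ?an ?sr' ?r'r ?orbT//.
by apply: ole_trans zc _; exact: ole_add2l.
Qed.

Lemma dlt_head d' d : dlt d' d -> (head (0, 0) d').1 = (head (0, 0) d).1 :> nat.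
Proof. by case: d' d => [|p' r'] [|p r] //= /andP[/eqP]. Qed.

Lemma oval_head d M j : size d = M.+1 ->
  ole (omul (omega_pow M) (ofin j)) (oval d) ->
  olt (oval d) (omul (omega_pow M) (ofin j.+1)) -> (head (0, 0) d).2 = j :> nat.
Proof.
case: d => [//|p r] [sr] /= jd dj; rewrite -sr in jd dj.
apply/eqP; rewrite eqn_leq; apply/andP; split; rewrite leqNgt; apply/negP => H.
- apply: (@olt_irr (oval (p :: r))); apply: olt_le_trans dj _ => /=.
  apply: ole_trans (ole_addr _ _); exact: ole_mul_fin _ H.
- apply: (@olt_irr (oval (p :: r))).
  apply: olt_le_trans (oval_lt_step _ (oval_lt r)) _; apply: ole_trans jd.
  exact: ole_mul_fin.
Qed.

(** * The tree of decreasing chains *)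

Section digit_tree.
Variables (M n : nat) (Z : eqType).
Local Notation label := (digits * Z)%type.
Implicit Types s t : seq label.

(** The first letter of every word belongs to one fixed system of size [n], so
    that the tree has rank [omega^M * n]. *)
Definition admissible (l : label) : bool :=
  [&& valid l.1, size l.1 == M.+1 & (head (0, 0) l.1).1 == n]%N.

Definition descends (l l' : label) : bool := dlt l'.1 l.1.

Definition chain s : bool := all admissible s && sorted descends s.

Definition digit_tree : set (seq label) := [set s | (s != [::]) && chain s].

Definition last_val s : tord := oval (last [::] (map fst s)).

Lemma descends_trans : transitive descends.
Proof. by move=> b a c ab bc; exact: dlt_trans bc ab. Qed.

Lemma last_valE x s : last_val (x :: s) = oval (last x s).1.
Proof. by rewrite /last_val /= (last_map fst). Qed.

Lemma chain_prefix s t : prefix s t -> chain t -> chain s.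
Proof.
move=> /prefixP[u ->]; rewrite /chain all_cat => /andP[/andP[-> _]].
by move=> H; have := cat_sorted2 H => -[->].
Qed.

Lemma admissible_dlt l l' : admissible l -> admissible l' -> descends l l' ->
  olt (oval l'.1) (oval l.1).
Proof.
move=> /and3P[_ /eqP sl _] /and3P[_ /eqP sl' _]; apply: dlt_oval.
by rewrite sl sl'.
Qed.

Lemma last_val_lt s t : s != [::] -> proper_prefix s t -> chain t ->
  olt (last_val t) (last_val s).
Proof.
case: s => [//|x s] _ /andP[/prefixP[[|y u] ->]]; first by rewrite cats0 eqxx.
move=> _ /andP[/allP adm] /=; rewrite cat_path => /andP[_ Hp].
rewrite !last_valE last_cat; apply: admissible_dlt.
- by apply: adm; rewrite mem_cat mem_last.
- by apply: adm; rewrite mem_cat; apply/orP; right; exact: (mem_last y u).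
- by have /allP H := order_path_min descends_trans Hp; exact: H _ (mem_last y u).
Qed.

Lemma chain_rcons s d z : chain s ->
  (s = [::] \/ dlt d (last [::] (map fst s))) -> admissible (d, z) -> chain (rcons s (d, z)).
Proof.
move=> /andP[As Ss] Hd ad; rewrite /chain all_rcons ad As /=.
case: s As Ss Hd => [//|x s] As Ss [//|] /=; rewrite (last_map fst) => Hd.
by rewrite rcons_path; apply/andP; split.
Qed.

Lemma digit_tree_is_tree : is_tree digit_tree.
Proof.
split=> // s t /andP[_ s0] st /andP[_ ct]; apply/andP; split; last exact: chain_prefix ct.
by rewrite eq_sym.
Qed.

(** A node can be extended to digits denoting any ordinal below its own, so
    its rank in the tree is the ordinal that its last label denotes. *)
Lemma chain_extend s xi : digit_tree s -> olt xi (last_val s) ->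
  exists2 d, forall z, digit_tree (rcons s (d, z)) & ole xi (oval d).
Proof.
move=> /andP[s0 cs] xis; case: s s0 cs xis => [//|x s] _ cs.
rewrite last_valE => /oval_cofinal[|d [vd sd dl xid]].
  by case/andP: cs => /allP/(_ _ (mem_last x s))/andP[].
exists d => // z; apply/andP; split; first by case: (s).
apply: chain_rcons => //; first by right; rewrite /= (last_map fst).
case/andP: cs => /allP/(_ _ (mem_last x s))/and3P[_ /eqP sl /eqP hl] _.
by rewrite /admissible vd sd sl eqxx (dlt_head dl) hl eqxx.
Qed.

Lemma last_val_rcons s d z : last_val (rcons s (d, z)) = oval d.
Proof. by rewrite /last_val map_rcons last_rcons. Qed.

Variable z0 : Z.

Lemma digit_tree_derived xi : tree_derived digit_tree xi =
  [set s | digit_tree s /\ ole xi (last_val s)].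
Proof.
rewrite /tree_derived; elim: xi => [|xi IH|I h f IH] /=.
- by apply/seteqP; split => s //= [].
- rewrite IH; apply/seteqP; split => s /=.
    move=> [[Ts xis] nmax]; split=> //; apply: contrapT => H; apply: nmax.
    split=> // t [Tt xit] st; apply/eqP; rewrite eq_sym; apply: contrapT => /negP ts.
    apply: H; apply: ole_lt_trans xit _; case/andP: Ts => s0 _; case/andP: Tt => _ ct.
    by apply: last_val_lt => //; apply/andP.
  move=> [Ts xis]; split; first by split=> //; exact: oltW.
  move=> [_ smax]; have [d Td xid] := chain_extend Ts xis.
  have /(congr1 size)/eqP := smax (rcons s (d, z0))
    (conj (Td z0) (eq_ind_r (ole xi) xid (last_val_rcons s d z0))) (prefix_rcons _ _).
  by rewrite size_rcons eqn_leq ltnn.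
- apply/seteqP; split => s /=.
    move=> H; split; first by case: (h) => i; have := H i Logic.I; rewrite IH => -[].
    by move=> i; have := H i Logic.I; rewrite IH => -[].
  by move=> [Ts xis] i _; rewrite IH.
Qed.

(** Adjoining the root does not change the derived trees away from the root. *)
Lemma rooted_digit_tree_derived xi s :
  tree_derived ([set [::]] `|` digit_tree) xi s ->
  s = [::] \/ (digit_tree s /\ ole xi (last_val s)).
Proof.
rewrite /tree_derived; elim: xi s => [|xi IH|I h f IH] s /=.
- by case=> [->|Ts]; [left|right].
- move=> [Ds nmax]; have [->|[Ts xis]] := IH _ Ds; [by left|right; split=> //].
  apply: contrapT => H; apply: nmax; split=> // t Dt st.
  have [t0|[Tt xit]] := IH _ Dt.
    by rewrite t0; rewrite t0 prefixs0 in st; rewrite (eqP st).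
  apply/eqP; rewrite eq_sym; apply: contrapT => /negP ts.
  apply: H; apply: ole_lt_trans xit _; case/andP: Ts => s0 _; case/andP: Tt => _ ct.
  by apply: last_val_lt => //; apply/andP.
- move=> H; have [->|s0] := eqVneq s [::]; [by left|right].
  have H' i : digit_tree s /\ ole (f i) (last_val s).
    by have [s0'|//] := IH i _ (H i Logic.I); rewrite s0' in s0.
  by split=> [|i]; [case: (h) => i; case: (H' i)|case: (H' i)].
Qed.

Lemma last_val_bound s : digit_tree s ->
  olt (last_val s) (omul (omega_pow M) (ofin n)).
Proof.
case: s => [//|x s] /andP[_ /andP[/allP/(_ _ (mem_last x s))]] + _.
rewrite last_valE /admissible; case: (last x s).1 => [//|p r] /and3P[/= /andP[pn _] /eqP[sr] /eqP hp].
rewrite -sr -hp; apply: olt_le_trans (oval_lt_step _ (oval_lt r)) _.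
exact: ole_mul_fin.
Qed.

Lemma digit_tree_cofinal xi : olt xi (omul (omega_pow M) (ofin n)) ->
  exists2 d, forall z, digit_tree [:: (d, z)] & ole xi (oval d).
Proof.
move=> /omega_pow_mul_cofinal_digits[d [vd sd hd xid]]; exists d => // z.
by rewrite /digit_tree /= /chain /= /admissible /= vd sd hd !eqxx.
Qed.

Lemma digit_tree_rank : has_rank digit_tree (omul (omega_pow M) (ofin n)).
Proof.
split=> [|b]; rewrite digit_tree_derived.
  apply/seteqP; split => s //= [/last_val_bound H1 H2].
  by apply: (@olt_irr (last_val s)); exact: olt_le_trans H1 H2.
move=> Db; have [//|/digit_tree_cofinal[d Td bd]] := ole_total (omul (omega_pow M) (ofin n)) b.
have : [set s | digit_tree s /\ ole b (last_val s)] [:: (d, z0)].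
  by split; [exact: Td|rewrite last_valE].
by rewrite Db.
Qed.

(** The conditions on a label only concern its word, so a successor may carry an
    arbitrary second component; this is what makes the tree weakly null. *)
Lemma digit_tree_successors xi t :
  tree_derived ([set [::]] `|` digit_tree) (OSucc xi) t ->
  exists d, forall z, tree_derived digit_tree xi (rcons t (d, z)).
Proof.
move=> /[dup] /rooted_digit_tree_derived[-> H|[Tt xit] _]; last first.
  have [d Td xid] := chain_extend Tt xit; exists d => z.
  by rewrite digit_tree_derived; split=> //; rewrite last_val_rcons.
have [s [Ts xis]] : exists s, digit_tree s /\ ole xi (last_val s).
  apply: contrapT => H'; case: H => D0; apply; split=> // s Ds _.
  have [//|Ts] := rooted_digit_tree_derived Ds.
  by case: H'; exists s.
have [d Td xid] := digit_tree_cofinal (ole_lt_trans xis (last_val_bound Ts)).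
by exists d => z; rewrite digit_tree_derived; split=> //=; rewrite last_valE.
Qed.

End digit_tree.

(** * Sums along chains of digits *)

Definition digit (d : digits) (l : nat) : nat * nat := nth (0, 0)%N d l.

(** Summing level by level: all the words of a chain have the same size at their
    first level; those with the same index there have tails that form a chain
    again, and the weights of the distinct indices add up to at most [W 0]. *)
Lemma chain_sum_le (R : realType) (L : nat) (w : nat -> nat -> nat -> R) (W : nat -> R)
    (c : seq digits) :
  (forall l n a, 0 <= w l n a) ->
  (forall l n, (l < L)%N -> \sum_(a < n) w l n a <= W l) ->
  all (fun d => valid d && (size d == L)) c -> pairwise (fun d d' => dlt d' d) c ->
  \sum_(d <- c) \prod_(l < L) w l (digit d l).1 (digit d l).2 <= \prod_(l < L) W l.
Proof.
elim: L w W c => [|L IH] w W c w0 wW adm dec.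
  rewrite big_ord0; case: c adm dec => [|d [|d' c]]; first by rewrite big_nil ler01.
    by rewrite big_seq1 big_ord0.
  by move=> /and3P[/andP[_ /eqP/size0nil->] /andP[_ /eqP/size0nil->] _].
have W0 l : (l < L.+1)%N -> 0 <= W l by move=> /(wW l 0%N); rewrite big_ord0.
have PW0 : 0 <= \prod_(l < L) W (bump 0 l).
  by apply: prodr_ge0 => l _; apply: W0; rewrite ltnS; exact: ltn_ord.
case: c adm dec => [|d0 c0] adm dec.
  by rewrite big_nil prodr_ge0// => l _; exact: W0.
set c := d0 :: c0 in adm dec *.
pose n := (head (0, 0)%N d0).1.
have hd d : d \in c -> exists2 a, (a < n)%N & exists2 r, d = (n, a) :: r & valid r /\ size r = L.
  move=> dc; have /andP[vd /eqP sd] := allP adm _ dc.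
  have hn : (head (0, 0)%N d).1 = n.
    move: dc; rewrite inE => /orP[/eqP->//|dc0].
    by move: dec => /= /andP[/allP/(_ _ dc0)/dlt_head].
  case: d vd sd hn {dc} => [//|[n' a] r] /= /andP[an vr] [sr] <-.
  by exists a => //; exists r.
rewrite big_ord_recl big_seq.
have -> : \sum_(d <- c | d \in c) \prod_(l < L.+1) w l (digit d l).1 (digit d l).2 =
    \sum_(a < n) w 0%N n a * \sum_(d <- [seq behead d | d <- c & (head (0, 0)%N d).2 == a])
      \prod_(l < L) w l.+1 (digit d l).1 (digit d l).2.
  rewrite (eq_bigr (fun a : 'I_n => \sum_(d <- c | (head (0, 0)%N d).2 == a)
      \prod_(l < L.+1) w l (digit d l).1 (digit d l).2)); last first.
    move=> a _; rewrite big_map big_filter mulr_sumr big_seq_cond [RHS]big_seq_cond.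
    apply: eq_bigr => d /andP[/hd[b bn [r -> _]] /= /eqP ba].
    by rewrite big_ord_recl /= ba; congr (_ * _).
  rewrite (exchange_big_dep xpredT)//= big_seq; apply: eq_bigr => d /hd[b bn [r -> _]] /=.
  by rewrite (big_pred1 (Ordinal bn)).
apply: le_trans (_ : \sum_(a < n) w 0%N n a * \prod_(l < L) W (bump 0 l) <= _).
  apply: ler_sum => a _; rewrite ler_wpM2l//.
  apply: (IH (fun l => w l.+1) (fun l => W l.+1)) => //.
  - by move=> l m lL; exact: wW.
  - apply/allP => _ /mapP[d + ->]; rewrite mem_filter => /andP[_ /hd[b _ [r -> [vr sr]]]] /=.
    by rewrite vr sr eqxx.
  - rewrite pairwise_map; apply: (@sub_in_pairwise _ [in [seq d <- c | (head (0, 0)%N d).2 == a]]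
        (fun d d' => dlt d' d)) => [d d'| |]; last exact: pairwise_filter.
      rewrite !mem_filter => /andP[/eqP da /hd[b _ [r E _]]] /andP[/eqP d'a /hd[b' _ [r' E' _]]].
      move: da d'a; rewrite {}E {}E' /= => -> ->.
      by rewrite !eqxx ltnn.
    exact/allP.
by rewrite -mulr_suml; apply: ler_wpM2r => //; exact: wW.
Qed.

Lemma dlt_first_difference d' d : size d' = size d -> dlt d' d ->
  exists l, [/\ (l < size d)%N, (digit d' l).1 = (digit d l).1,
    ((digit d' l).2 < (digit d l).2)%N & forall j, (j < l)%N -> digit d' j = digit d j].
Proof.
elim: d' d => [|[n' a'] r' IH] [|[n a] r] //= [sz] /andP[/eqP /= ->].
case/orP => [lt|/andP[/eqP -> /(IH _ sz)[l [lr e1 lt e2]]]]; first by exists 0%N.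
by exists l.+1; split => // -[//|j] /e2.
Qed.

Lemma valid_digit d l : valid d -> (l < size d)%N -> ((digit d l).2 < (digit d l).1)%N.
Proof. by move=> /all_nthP; exact. Qed.

(** * The weak and weak-star topologies *)

Section pointwise_topology.
Variables (R : realType) (K : numFieldType) (re : K -> R) (S : scalars re).
Local Notation N := (rnorm re).

(** The filter generated by the finite sets of conditions converges pointwise to
    [f], hence is finer than the neighbourhoods of [f]. *)
Lemma pointwise_nbhs (X : Type) (f : {ptws X -> K^o}) (V : set {ptws X -> K^o}) :
  nbhs f V -> exists r (x : 'I_r -> X), exists2 e : R, 0 < e &
    forall g : X -> K^o, (forall j, N (g (x j) - f (x j)) < e) -> V g.
Proof.
pose base (t : seq X * R) : set {ptws X -> K^o} :=
  [set g | forall x, List.In x t.1 -> N (g x - f x) < t.2].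
pose F := filter_from [set t : seq X * R | 0 < t.2] base.
have FF : Filter F.
  apply: filter_from_filter; first by exists ([::], 1) => /=.
  move=> [s d] [s' d'] /= d0 d'0; exists (s ++ s', Num.min d d').
    by rewrite /= lt_min d0.
  move=> g /= H; split=> x xs; have := H x; rewrite lt_min => {}H.
    by have /andP[] := H (List.in_or_app _ _ _ (or_introl xs)).
  by have /andP[] := H (List.in_or_app _ _ _ (or_intror xs)).
have Ff : F --> f.
  apply/cvg_sup => x; apply/cvg_image.
    by rewrite eqEsubset; split=> v // _; exists (cst v).
  move=> A; rewrite -nbhs_ballE => -[e /= e0 eA].
  exists [set g : {ptws X -> K^o} | A (g x)]; last first.
    by apply/seteqP; split=> [_ [g Ag <-]//|v Av]; exists (cst v).
  exists ([:: x], re e) => /=.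
    by rewrite lt_neqAle (re_ge0 S (ltW e0)) andbT -(inj_eq (fmorph_inj (emb S)))
      (emb_re S) ?(ltW e0)// rmorph0 lt_eqF.
  move=> g /(_ x (or_introl erefl)) gx; apply: eA; rewrite /ball /= distrC.
  rewrite -(emb_rnorm S) -(emb_re S (ltW e0)).
  by rewrite lt_neqAle (inj_eq (fmorph_inj (emb S))) (emb_le S) -lt_neqAle.
move=> /Ff [[s d] /= d0 sV].
exists (size s), (tnth (in_tuple s)), d => // g gs; apply: sV => x xs.
have [n [ns nx]] : exists n, (n < size s)%N /\ x = List.nth n s x.
  have [n [/ssrnat.ltP ns nx]] := List.In_nth s x x xs; by exists n.
have := gs (Ordinal ns); rewrite (tnth_nth x) /=.
suff -> : nth x s n = x by [].
by rewrite [RHS]nx; elim: s n {ns xs gs nx} => [|y s IH] [|n] //=.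
Qed.

(** Weak neighbourhoods of 0 are given by finitely many functionals, whose exact
    common zeros are enough here. *)
Lemma weak_closure_common_zero (X : normedModType K) (A : set X) :
  (forall r (f : 'I_r -> X -> K^o), (forall j, linear (f j)) ->
    exists2 a, A a & forall j, f j a = 0) ->
  weak_closure A 0.
Proof.
move=> H B [C [[D oD <-] /= D0 CB]].
have : nbhs (dual_eval (0 : X)) D by exact: open_nbhs_nbhs.
move=> /pointwise_nbhs[r [f [e e0 eD]]].
have lf j : linear (\val (f j) : X -> K^o).
  by case: (f j) => g /= /set_mem[].
have [a Aa fa] := H r (fun j => \val (f j)) lf.
exists a; split=> //; apply: CB; apply: eD => j.
have -> : dual_eval a (f j) = 0 by exact: fa.
have -> : dual_eval 0 (f j) = 0 by exact: linear_fun0.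
by rewrite subrr (rnorm0 S).
Qed.

Lemma bounded_continuous (X : normedModType K) (f : X -> K^o) :
  linear f -> (forall x, N (f x) <= N x) -> continuous f.
Proof.
move=> lf fN x; apply/cvgrPdist_lt => e e0.
near=> y.
have -> : f x - f y = f (x - y).
  by rewrite [x - y]addrC -[- y]scaleN1r lf scaleN1r addrC.
apply: le_lt_trans (_ : `|x - y| < e).
  by rewrite -!(emb_rnorm S) (emb_le S).
by near: y; apply: cvgr_dist_lt.
Unshelve. all: by end_near.
Qed.

Lemma dual_ballP (X : normedModType K) (f : {ptws X -> K^o}) :
  dual_ball re f <-> linear (f : X -> K^o) /\ forall x, N (f x) <= N x.
Proof.
split=> [[[lf _] fB]|[lf fN]].
  split=> // x; have [->|x0] := eqVneq x 0; first by rewrite (linear_fun0 lf) !(rnorm0 S).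
  have Nx : 0 < N x.
    rewrite lt_neqAle (rnorm_ge0 S) andbT eq_sym.
    by apply: contra_neq x0; exact: (rnorm_eq0 S).
  have : ((N (f (emb S (N x)^-1 *: x)))%:E <= 1)%E.
    apply: le_trans fB; apply: ereal_sup_ubound; exists (emb S (N x)^-1 *: x) => //.
    rewrite /unit_ball /= (rnorm_le1 S) (rnormZ S) (rnorm_emb S) ?invr_ge0 ?(ltW Nx)//.
    by rewrite mulVf ?gt_eqF.
  rewrite lee_fin linear_funZ// (rnormZ S) (rnorm_emb S) ?invr_ge0 ?(ltW Nx)//.
  by rewrite mulrC ler_pdivrMr// mul1r.
split; first by split=> //; exact: bounded_continuous.
apply: ge_ereal_sup => _ [x + <-]; rewrite /unit_ball /= (rnorm_le1 S) => x1.
by rewrite lee_fin; apply: le_trans x1.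
Qed.

End pointwise_topology.

(** * Multilinear forms and their extensions to the tensor product *)

Section forms.
Variables (R : realType) (K : numFieldType) (re : K -> R).
Hypothesis hK : real_or_complex re.
Variable S : scalars re.
Local Notation N := (rnorm re).
Variables (k : nat) (Y : 'I_k -> completeNormedModType K).
Local Notation P := (forall j, Y j).

Lemma dfwith_id (y : P) j : eqtype.dfwith y (y j) = y.
Proof.
apply: functional_extensionality_dep => l.
have [<-|jl] := eqVneq j l; first by rewrite dfwith_in.
by rewrite dfwith_out.
Qed.

Definition prod_form (G : forall j, Y j -> K^o) (y : P) : K^o :=
  \prod_(j < k) (G j (y j) : K).

Lemma prod_form_multilinear (G : forall j, Y j -> K^o) :
  (forall j, linear (G j)) -> multilinear (prod_form G).
Proof.
move=> lG j y c u v.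
have E w : prod_form G (eqtype.dfwith y w) =
    G j w * \prod_(l < k | l != j) (G l (y l) : K).
  rewrite /prod_form (bigD1 j)//= dfwith_in; congr (_ * _).
  by apply: eq_bigr => l lj; rewrite dfwith_out// eq_sym.
by rewrite !E lG /GRing.scale /= mulrDl mulrA.
Qed.

Lemma multilinear_sum (I : Type) (s : seq I) (phi : I -> P -> K^o) :
  (forall l, multilinear (phi l)) -> multilinear (fun y => \sum_(l <- s) phi l y).
Proof.
move=> mphi j y c u v; rewrite scaler_sumr -big_split.
by apply: eq_bigr => l _; exact: mphi.
Qed.

Variables (Z : completeNormedModType K) (tau : P -> Z).
Hypothesis tauZ : is_projective_tensor_product re tau.
Hypothesis k0 : (0 < k)%N.

Let nsum (u : seq P) : R := \sum_(y <- u) \prod_(j < k) N (y j).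

Lemma tensor_norm_le u : N (\sum_(y <- u) tau y) <= nsum u.
Proof.
case: tauZ => _ -> _; apply: ge_inf; last by exists u.
exists 0 => _ [v _ <-]; apply: sumr_ge0 => y _; apply: prodr_ge0 => j _.
exact: (rnorm_ge0 S).
Qed.

Lemma elementary_tensor_norm_le y : N (tau y) <= \prod_(j < k) N (y j).
Proof. by have := tensor_norm_le [:: y]; rewrite /nsum !big_seq1. Qed.

(** Any representation of the tensor bounds the form, hence so does the infimum
    over representations. *)
Lemma form_le_tensor_norm (phi : P -> K^o) : multilinear phi ->
  (forall y, N (phi y) <= \prod_(j < k) N (y j)) ->
  forall u, N (\sum_(y <- u) phi y) <= N (\sum_(y <- u) tau y).
Proof.
move=> mphi phiN u; case: tauZ => _ -> _; apply: lb_le_inf.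
  by exists (nsum u), u.
move=> _ [v uv <-]; rewrite (uv _ mphi).
by apply: le_trans (rnorm_sum S _ _ _) _; exact: ler_sum.
Qed.

(** The form is dominated by the projective norm on finite sums of elementary
    tensors, so the Hahn-Banach theorem applies to the graph that it defines. *)
Lemma form_extension (phi : P -> K^o) : multilinear phi ->
  (forall y, N (phi y) <= \prod_(j < k) N (y j)) ->
  exists2 f : {ptws Z -> K^o}, dual_ball re f & forall y, f (tau y) = phi y.
Proof.
move=> mphi phiN.
have mtau : multilinear tau by case: tauZ.
pose j0 := Ordinal k0.
pose scale c (y : P) : P := eqtype.dfwith y (c *: y j0).
have scaleE (W : lmodType K) (psi : P -> W) : multilinear psi ->
    forall c y, psi (scale c y) = c *: psi y.
  move=> mpsi c y; have := linear_funZ c (y j0) (mpsi j0 y).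
  by rewrite dfwith_id.
have [||v a [u -> ->]|f [lf fN fG]] := @hahn_banach _ _ _ hK Z
    (fun z a => exists2 u, z = \sum_(y <- u) tau y & a = \sum_(y <- u) (phi y : K)).
- by exists [::]; rewrite big_nil.
- move=> c _ _ _ _ [u -> ->] [v -> ->]; exists ([seq scale c y | y <- u] ++ v).
    rewrite big_cat big_map /= scaler_sumr; congr (_ + _).
    by apply: eq_bigr => y _; rewrite scaleE.
  rewrite big_cat big_map /= mulr_sumr; congr (_ + _).
  by apply: eq_bigr => y _; rewrite scaleE.
- exact: form_le_tensor_norm.
exists f; first exact/(dual_ballP S).
by move=> y; apply: fG; exists [:: y]; rewrite big_seq1.
Qed.

Lemma tensor_approx (z : Z) (e : R) : 0 < e ->
  exists u, N (z - \sum_(y <- u) tau y) < e.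
Proof.
move=> e0; case: tauZ => _ _ dtau.
have [|w [+ [u _ wu]]] := dtau (ball z (emb S e))^° _ (open_interior _).
  exists z; apply: nbhsx_ballx; rewrite lt_neqAle (emb_ge0 S) (ltW e0) andbT.
  by rewrite eq_sym fmorph_eq0 gt_eqF.
move=> /interior_subset; rewrite -ball_normE /= -wu => H; exists u.
rewrite lt_neqAle -(emb_le S) (emb_rnorm S) (ltW H) andbT.
apply/eqP => Ne; move: H; by rewrite -Ne (emb_rnorm S) ltxx.
Qed.

End forms.

(** * Forms attached to words *)
Section digit_forms.
Variables (R : realType) (K : numFieldType) (re : K -> R).
Variable S : scalars re.
Local Notation N := (rnorm re).
Variables (k : nat) (Y : 'I_k -> completeNormedModType K).
Local Notation P := (forall j, Y j).
Variables (e : 'I_k) (L : nat) (level : 'I_k -> nat).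
Variables (F : forall j, nat -> nat -> Y j -> K^o) (V : forall j, nat -> nat -> Y j).

(** The letters of [d] are assigned to the factors through [level]; the factor
    [e] is left to the functional [h]. *)
Definition digit_form (d : digits) (h : Y e -> K^o) : P -> K^o :=
  prod_form (eqtype.dfwith (T := fun j => Y j -> K^o)
    (fun j => F (digit d (level j)).1 (digit d (level j)).2) h).

Definition digit_vector (d : digits) (z : Y e) : P :=
  eqtype.dfwith (T := Y) (fun j => V j (digit d (level j)).1 (digit d (level j)).2) z.

Definition chain_form (c : seq digits) (h : digits -> Y e -> K^o) (y : P) : K^o :=
  \sum_(d <- c) digit_form d (h d) y.

Definition digit_chain (c : seq digits) : bool :=
  all (fun d => valid d && (size d == L)) c && pairwise (fun d d' => dlt d' d) c.

Lemma digit_formE d h y : digit_form d h y =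
  (\prod_(j < k | j != e) F (digit d (level j)).1 (digit d (level j)).2 (y j) : K) *
  h (y e).
Proof.
rewrite /digit_form /prod_form (bigD1 e)//= dfwith_in mulrC; congr (_ * _).
by apply: eq_bigr => j je; rewrite dfwith_out// eq_sym.
Qed.

Lemma digit_form_vector d d' h z : digit_form d h (digit_vector d' z) =
  (\prod_(j < k | j != e) F (digit d (level j)).1 (digit d (level j)).2
    (V j (digit d' (level j)).1 (digit d' (level j)).2) : K) * h z.
Proof.
rewrite digit_formE /digit_vector dfwith_in; congr (_ * _).
by apply: eq_bigr => j je; rewrite dfwith_out// eq_sym.
Qed.

Hypothesis F_linear : forall j n a, linear (@F j n a).

Lemma digit_form_multilinear d h : linear h -> multilinear (digit_form d h).
Proof.
move=> lh; apply: prod_form_multilinear => j.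
have [<-|ej] := eqVneq e j; first by rewrite dfwith_in.
by rewrite dfwith_out.
Qed.

Lemma chain_form_multilinear c h : (forall d, linear (h d)) ->
  multilinear (chain_form c h).
Proof.
by move=> lh; apply: multilinear_sum => d; exact: digit_form_multilinear.
Qed.

Hypothesis level_lt : forall j, j != e -> (level j < L)%N.

(** Regrouping the factors by level turns the product over factors into one to
    which [chain_sum_le] applies. *)
Lemma prod_by_level (T : comNzRingType) (G : 'I_k -> T) :
  \prod_(j < k | j != e) G j =
  \prod_(l < L) \prod_(j < k | (j != e) && (level j == l)) G j.
Proof.
rewrite (exchange_big_dep (fun j => j != e))//=; last by move=> l j _ /andP[].
apply: eq_bigr => j je.
rewrite (big_pred1 (Ordinal (level_lt je)))// => l.
by rewrite je /= -val_eqE /= eq_sym.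
Qed.

Hypothesis F_level : forall l n (y : P), (l < L)%N ->
  \sum_(a < n) \prod_(j < k | (j != e) && (level j == l)) N (F n a (y j)) <=
  \prod_(j < k | (j != e) && (level j == l)) N (y j).

Lemma chain_form_bound c h y : digit_chain c ->
  (forall d z, N (h d z) <= N z) ->
  N (chain_form c h y) <= \prod_(j < k) N (y j).
Proof.
move=> /andP[adm dec] hN; apply: le_trans (rnorm_sum S _ _ _) _.
rewrite (bigD1 e)//= mulrC prod_by_level.
pose w l n a := \prod_(j < k | (j != e) && (level j == l)) N (F n a (y j)).
apply: le_trans (_ : \sum_(d <- c) (\prod_(l < L) w l (digit d l).1 (digit d l).2) * N (y e) <= _).
  apply: ler_sum => d _; rewrite digit_formE (rnormM S) (rnorm_prod S).
  have -> : \prod_(l < L) w l (digit d l).1 (digit d l).2 =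
      \prod_(j < k | j != e) N (F (digit d (level j)).1 (digit d (level j)).2 (y j)).
    rewrite prod_by_level; apply: eq_bigr => l _; apply: eq_bigr => j.
    by move=> /andP[_ /eqP->].
  rewrite ler_wpM2l//; apply: prodr_ge0 => j _; exact: (rnorm_ge0 S).
rewrite -mulr_suml ler_wpM2r ?(rnorm_ge0 S)//.
apply: (@chain_sum_le _ L w
  (fun l => \prod_(j < k | (j != e) && (level j == l)) N (y j))) => //.
  by move=> l n a; apply: prodr_ge0 => j _; exact: (rnorm_ge0 S).
by move=> l n lL; exact: F_level.
Qed.

End digit_forms.

(** * Systems of functionals on all factors *)
Lemma sum_cauchy_schwarz (R : realType) n (x y : 'I_n -> R) (A B : R) :
  0 <= A -> 0 <= B -> (forall a, 0 <= x a) -> (forall a, 0 <= y a) ->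
  \sum_a x a ^+ 2 <= A ^+ 2 -> \sum_a y a ^+ 2 <= B ^+ 2 -> \sum_a x a * y a <= A * B.
Proof.
move=> A0 B0 x0 y0 xA yB.
have zero (u : 'I_n -> R) : \sum_a u a ^+ 2 <= 0 -> forall a, u a = 0.
  move=> u0 a; apply/eqP; rewrite -sqrf_eq0 eq_le sqr_ge0 andbT.
  apply: le_trans u0; rewrite (bigD1 a)//= lerDl.
  by apply: sumr_ge0 => b _; exact: sqr_ge0.
have [A1|A1] := eqVneq A 0.
  rewrite A1 expr0n /= in xA; rewrite big1 ?A1 ?mul0r// => a _.
  by rewrite (zero x) ?mul0r.
have [B1|B1] := eqVneq B 0.
  rewrite B1 expr0n /= in yB; rewrite big1 ?B1 ?mulr0// => a _.
  by rewrite (zero y) ?mulr0.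
have AB : 0 < A * B by rewrite mulr_gt0// lt_neqAle eq_sym ?A1 ?B1.
rewrite -(ler_pM2l AB) mulr_sumr.
apply: le_trans (_ : \sum_a (B ^+ 2 * x a ^+ 2 + A ^+ 2 * y a ^+ 2) / 2 <= _).
  apply: ler_sum => a _; have := sqr_ge0 (B * x a - A * y a).
  rewrite !expr2; lra.
rewrite -mulr_suml big_split /= -!mulr_sumr.
have := ler_wpM2l (sqr_ge0 B) xA; have := ler_wpM2l (sqr_ge0 A) yB.
rewrite !expr2; lra.
Qed.

Section digit_systems.
Variables (R : realType) (K : numFieldType) (re : K -> R).
Hypothesis hK : real_or_complex re.
Variable S : scalars re.
Local Notation N := (rnorm re).

(** Reversing the order of the functionals turns a lower triangular system into
    an upper triangular one. *)
Lemma triangular_system (Y : normedModType K) (lower : bool) :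
  infinite_dimensional Y ->
  exists (f : nat -> nat -> Y -> K^o) (v : nat -> nat -> Y),
  [/\ forall n a, linear (f n a),
      forall n y, \sum_(a < n) N (f n a y) ^+ 2 <= N y ^+ 2,
      forall n a, (a < n)%N -> N (v n a) <= 1,
      forall n a, (a < n)%N -> f n a (v n a) = emb S 2^-1 &
      forall n a b, (a < n)%N -> (b < n)%N -> (if lower then b < a else a < b)%N ->
        f n a (v n b) = 0].
Proof.
move=> infY; have [f /choice[v H]] := choice (dvoretzky_rogers hK S infY).
pose rv n a := if lower then a else (n - a.+1)%N.
exists (fun n a => f n (rv n a)), (fun n a => v n (rv n a)).
have rvlt n a : (a < n)%N -> (rv n a < n)%N by rewrite /rv; case: (lower); lia.
split=> [n a|n y|n a an|n a an|n a b an bn ab].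
- by case: (H n).
- case: (H n) => _ /(_ y) + _ _ _; rewrite /rv; case: (lower) => //.
  rewrite [in X in X -> _](reindex_inj rev_ord_inj) /=; exact.
- by case: (H n) => _ _ /(_ _ (rvlt _ _ an)).
- by case: (H n) => _ _ _ /(_ _ (rvlt _ _ an)).
- case: (H n) => _ _ _ _; apply; rewrite (rvlt _ _ an) andbT.
  by move: ab; rewrite /rv; case: (lower) => //; lia.
Qed.

Variables (k L : nat) (odd_offset : bool) (Y : 'I_k -> completeNormedModType K).
Variable e : 'I_k.
Hypothesis kE : (k + odd_offset = (L * 2).+1)%N.
Hypothesis eE : (e.+1 = k)%N.
Hypothesis infY : forall j, infinite_dimensional (Y j).

(** Consecutive factors are paired.  With [odd_offset], the factor 0 is alone on
    level 0; in both cases the last factor is left out. *)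
Definition pair_level (j : 'I_k) : nat := (j + odd_offset)./2.

Definition unpaired (j : 'I_k) : bool := odd_offset && (j == 0 :> nat).

Lemma pair_level_lt j : j != e -> (pair_level j < L)%N.
Proof.
rewrite -val_eqE /= /pair_level => je; have := ltn_ord j.
by move: kE eE je; case: odd_offset => /=; lia.
Qed.

Lemma unpaired_level l : odd_offset -> l = 0%N -> (l < L)%N ->
  exists2 j : 'I_k, (j == 0 :> nat) &
    forall i : 'I_k, (i != e) && (pair_level i == l) = (i == j).
Proof.
move=> oo -> L0; have k0 : (0 < k)%N by move: kE; rewrite oo; lia.
exists (Ordinal k0) => // j; rewrite -!val_eqE /= /pair_level oo.
have := ltn_ord j; move: kE eE; rewrite oo => /=.
by case: eqP; case: eqP; case: eqP => //=; lia.
Qed.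

Lemma two_element_level l : (l < L)%N -> ~~ (odd_offset && (l == 0%N)) ->
  exists j1 j2 : 'I_k, [/\ ~~ odd (j1 + odd_offset), odd (j2 + odd_offset),
    ~~ unpaired j1, ~~ unpaired j2 &
    (forall i : 'I_k, (i != e) && (pair_level i == l) = (i == j1) || (i == j2))].
Proof.
move=> lL ol.
have k1 : (l * 2 - odd_offset < k)%N by move: kE ol; case: odd_offset => /=; lia.
have k2 : (l * 2 + 1 - odd_offset < k)%N by move: kE ol; case: odd_offset => /=; lia.
exists (Ordinal k1), (Ordinal k2); rewrite /unpaired /=; split.
- by move: ol; case: odd_offset => /=; lia.
- by move: ol; case: odd_offset => /=; lia.
- by move: ol; case: odd_offset => /=; lia.
- by move: ol; case: odd_offset => /=; lia.
- move=> i; rewrite /= -!val_eqE /= /pair_level; have := ltn_ord i.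
  move: kE eE ol; case: odd_offset => /=;
  by case: eqP; case: eqP; case: eqP; case: eqP => //=; lia.
Qed.

Lemma prod_two (T : comNzRingType) (G : 'I_k -> T) (p : pred 'I_k) j1 j2 :
  j1 != j2 -> (forall i, p i = (i == j1) || (i == j2)) ->
  \prod_(i < k | p i) G i = G j1 * G j2.
Proof.
move=> j12 pE; rewrite (bigD1 j1) ?pE ?eqxx//=; congr (_ * _).
apply: big_pred1 => i; rewrite pE.
by case: eqVneq => [->|]; rewrite ?orbF ?andbT ?andbF //= (negbTE j12).
Qed.

(** On each pair one system is lower and the other upper triangular, so that
    distinct indices are separated by one of the two factors, and the bound on
    their level is the Cauchy-Schwarz inequality.  The system on the unpaired
    factor is divided by [sqrt n] to satisfy the same bound; it remains only
    triangular. *)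
Lemma digit_system : exists (F : forall j, nat -> nat -> Y j -> K^o)
    (V : forall j, nat -> nat -> Y j),
  [/\ forall j n a, linear (@F j n a),
      forall l n (y : forall j, Y j), (l < L)%N ->
        \sum_(a < n) \prod_(j < k | (j != e) && (pair_level j == l)) N (F j n a (y j)) <=
        \prod_(j < k | (j != e) && (pair_level j == l)) N (y j),
      forall j n a, (a < n)%N -> N (V j n a) <= 1 /\
        F j n a (V j n a) = emb S (if unpaired j then (Num.sqrt n%:R)^-1 / 2 else 2^-1),
      forall l n a b, (l < L)%N -> ~~ (odd_offset && (l == 0%N)) ->
        (a < n)%N -> (b < n)%N -> a != b ->
        exists2 j, (j != e) && (pair_level j == l) & F j n a (V j n b) = 0 &
      forall j n a b, unpaired j -> (b < a)%N -> (a < n)%N -> F j n a (V j n b) = 0].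
Proof.
pose Hsys (j : 'I_k) := cid (triangular_system (odd (j + odd_offset)) (@infY j)).
pose f j := projT1 (Hsys j).
pose Hv j := cid (projT2 (Hsys j)).
pose v j := projT1 (Hv j).
have Hfv (j : 'I_k) : [/\ forall n a, linear (f j n a),
    forall n y, \sum_(a < n) N (f j n a y) ^+ 2 <= N y ^+ 2,
    forall n a, (a < n)%N -> N (v j n a) <= 1,
    forall n a, (a < n)%N -> f j n a (v j n a) = emb S 2^-1 &
    forall n a b, (a < n)%N -> (b < n)%N ->
      (if odd (j + odd_offset) then b < a else a < b)%N -> f j n a (v j n b) = 0].
  exact: projT2 (Hv j).
pose F (j : 'I_k) n a y : K^o :=
  if unpaired j then emb S (Num.sqrt n%:R)^-1 *: f j n a y else f j n a y.
have sq n : (0 < n)%N -> 0 < Num.sqrt (n%:R : R) by rewrite sqrtr_gt0 ltr0n.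
exists F, v; split.
- move=> j n a c y z; have [lf _ _ _ _] := Hfv j; rewrite /F lf.
  by case: ifP => // _; rewrite scalerDr !scalerA [_ * c]mulrC.
- move=> l n y lL; have [/andP[oo /eqP l0]|ol] := boolP (odd_offset && (l == 0%N)).
    have [j j0 jE] := unpaired_level oo l0 lL.
    rewrite (big_pred1 _ jE) (eq_bigr (fun a : 'I_n => (Num.sqrt n%:R)^-1 * N (f j n a (y j)))); last first.
      move=> a _; rewrite (big_pred1 _ jE) /F /unpaired oo j0 /= (rnormZ S) (rnorm_emb S) ?invr_ge0 ?sqrtr_ge0//.
    have [->|n0] := eqVneq n 0%N; first by rewrite big_ord0 (rnorm_ge0 S).
    have n1 : 0 < Num.sqrt (n%:R : R) by rewrite sq// lt0n.
    rewrite -mulr_sumr mulrC ler_pdivrMr//.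
    rewrite (eq_bigr (fun a : 'I_n => N (f j n a (y j)) * 1)) => [|a _]; last by rewrite mulr1.
    apply: sum_cauchy_schwarz => //; rewrite ?(rnorm_ge0 S) ?sqrtr_ge0//.
    + by move=> a; exact: (rnorm_ge0 S).
    + by case: (Hfv j).
    + by rewrite sqr_sqrtr ?ler0n// expr1n sumr_const card_ord.
  have [j1 [j2 [odd1 odd2 /negbTE l1 /negbTE l2 pE]]] := two_element_level lL ol.
  have j12 : j1 != j2 by apply: contraNneq odd1 => ->.
  rewrite (prod_two _ j12 pE) (eq_bigr (fun a : 'I_n => N (f j1 n a (y j1)) * N (f j2 n a (y j2)))).
    apply: sum_cauchy_schwarz; rewrite ?(rnorm_ge0 S)//.
    + by move=> a; exact: (rnorm_ge0 S).
    + by move=> a; exact: (rnorm_ge0 S).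
    + by case: (Hfv j1).
    + by case: (Hfv j2).
  by move=> a _; rewrite (prod_two _ j12 pE) /F l1 l2.
- move=> j n a an; have [_ _ v1 fv _] := Hfv j; split; first exact: v1.
  rewrite /F fv//; case: ifP => // _.
  by rewrite [LHS](esym (rmorphM _ _ _)).
- move=> l n a b lL ol an bn ab.
  have [j1 [j2 [odd1 odd2 /negbTE l1 /negbTE l2 pE]]] := two_element_level lL ol.
  have [lt|gt|E] := ltngtP a b; last by rewrite E eqxx in ab.
    exists j1; first by rewrite pE eqxx.
    rewrite /F l1; have [_ _ _ _] := Hfv j1; apply => //.
    by rewrite (negbTE odd1).
  exists j2; first by rewrite pE eqxx orbT.
  rewrite /F l2; have [_ _ _ _] := Hfv j2; apply => //.
  by rewrite odd2.
- move=> j n a b jl ba an; rewrite /F jl; have [_ _ _ _ fv] := Hfv j.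
  rewrite fv ?scaler0//; first exact: ltn_trans an.
  by move: jl => /andP[-> /eqP->].
Qed.

End digit_systems.

Section digit_evaluation.
Variables (R : realType) (K : numFieldType) (re : K -> R).
Variable S : scalars re.
Local Notation N := (rnorm re).
Variables (k L : nat) (odd_offset : bool) (Y : 'I_k -> completeNormedModType K).
Variable e : 'I_k.
Hypothesis kE : (k + odd_offset = (L * 2).+1)%N.
Hypothesis eE : (e.+1 = k)%N.
Variables (F : forall j, nat -> nat -> Y j -> K^o) (V : forall j, nat -> nat -> Y j).
Local Notation level := (pair_level odd_offset).
Local Notation form := (digit_form (e := e) level F).
Local Notation vec := (digit_vector (e := e) level V).

Hypothesis V_spec : forall j n a, (a < n)%N -> N (V j n a) <= 1 /\
  F n a (V j n a) = emb S (if unpaired odd_offset j then (Num.sqrt n%:R)^-1 / 2 else 2^-1).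
Hypothesis F_separates : forall l n a b, (l < L)%N -> ~~ (odd_offset && (l == 0%N)) ->
  (a < n)%N -> (b < n)%N -> a != b ->
  exists2 j, (j != e) && (level j == l) & F n a (V j n b) = 0.
Hypothesis F_triangular : forall j n a b, unpaired odd_offset j -> (b < a)%N -> (a < n)%N ->
  F n a (V j n b) = 0.

Let level_lt j : j != e -> (level j < L)%N := pair_level_lt kE eE (j := j).

(** The value of a form on its own elementary tensor: one factor 1/2 for each of
    the [k - 1] systems, and the normalisation of the unpaired one. *)
Definition diagonal_value (n : nat) : R :=
  (if odd_offset then (Num.sqrt n%:R)^-1 else 1) * 2^-1 ^+ k.-1.

Lemma digit_form_diagonal d h z : (0 < L)%N || ~~ odd_offset -> valid d -> size d = L ->
  form d h (vec d z) = emb S (diagonal_value (digit d 0).1) * h z.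
Proof.
move=> L0 vd sd; rewrite digit_form_vector; congr (_ * _).
rewrite (eq_bigr (fun j => emb S (if unpaired odd_offset j then (Num.sqrt (digit d 0).1%:R)^-1 else 1) *
    emb S 2^-1)) => [|j je]; last first.
  have [|_ ->] := @V_spec j (digit d (level j)).1 (digit d (level j)).2.
    by apply: valid_digit => //; rewrite sd; exact: level_lt.
  rewrite -rmorphM; congr (emb S _); case: ifP => [/andP[oo /eqP j0]|]; last by rewrite mul1r.
  by rewrite /pair_level j0 oo.
rewrite big_split /= rmorphM; congr (_ * _); last first.
  rewrite prodr_const rmorphXn; congr (_ ^+ _).
  by have := cardC1 e; rewrite card_ord.
have [oo|no] := boolP odd_offset; last first.
  by rewrite big1 ?rmorph1// => j _; rewrite rmorph1.
have {}L0 : (0 < L)%N by move: L0; rewrite oo orbF.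
have [j j0 jE] := unpaired_level kE eE oo erefl L0.
have je : j != e by have := jE j; rewrite eqxx => /andP[].
rewrite (bigD1 j)//= big1 => [|i /andP[_ ij]].
  by rewrite /unpaired j0 /= mulr1.
rewrite /unpaired /=; case: eqP => [i0|]; last by rewrite rmorph1.
by move: ij; rewrite -val_eqE /= i0 eq_sym j0.
Qed.

Lemma digit_form_vanishes d d' h z l : (l < L)%N -> valid d -> valid d' ->
  size d = L -> size d' = L -> ~~ (odd_offset && (l == 0%N)) ->
  (digit d' l).1 = (digit d l).1 -> (digit d' l).2 != (digit d l).2 ->
  form d h (vec d' z) = 0.
Proof.
move=> lL vd vd' sd sd' ol dd' ne.
have [|||j /andP[je /eqP jl] Fj] := @F_separates l (digit d l).1 (digit d l).2 (digit d' l).2 lL ol.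
- by rewrite valid_digit ?sd.
- by rewrite -dd' valid_digit ?sd'.
- by rewrite eq_sym.
by rewrite digit_form_vector (bigD1 j)//= jl dd' Fj mul0r mul0r.
Qed.

(** At the first difference of two comparable words the sizes agree and the
    indices differ.  That level is a pair unless it is the unpaired level 0,
    hence the last hypothesis. *)
Lemma digit_form_comparable d d' h z : valid d -> valid d' ->
  size d = L -> size d' = L -> dlt d' d \/ dlt d d' ->
  (odd_offset -> (digit d' 0).2 = (digit d 0).2) ->
  form d h (vec d' z) = 0.
Proof.
move=> vd vd' sd sd' + H0; have ss' : size d' = size d by rewrite sd sd'.
case=> [/(dlt_first_difference ss')|/(dlt_first_difference (esym ss'))] [l [lL e1 lt _]].
  apply: (@digit_form_vanishes _ _ _ _ l) => //; first by rewrite -sd.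
    by apply/negP => /andP[/H0 + /eqP l0]; move: lt; rewrite l0; lia.
  by rewrite ltn_eqF.
apply: (@digit_form_vanishes _ _ _ _ l) => //; first by rewrite -sd'.
  by apply/negP => /andP[/H0 + /eqP l0]; move: lt; rewrite l0; lia.
by rewrite gtn_eqF.
Qed.

Lemma digit_form_triangular d d' h z : odd_offset -> (0 < L)%N -> valid d -> size d = L ->
  (digit d' 0).1 = (digit d 0).1 -> ((digit d' 0).2 < (digit d 0).2)%N ->
  form d h (vec d' z) = 0.
Proof.
move=> oo L0 vd sd d1 d2.
have [j j0 /(_ j)] := unpaired_level kE eE oo erefl L0; rewrite eqxx => /andP[je /eqP jl].
rewrite digit_form_vector (bigD1 j)//= jl d1 F_triangular ?mul0r//.
  by rewrite /unpaired oo.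
by apply: valid_digit; rewrite ?sd.
Qed.

Lemma digit_vector_le1 d z : valid d -> size d = L -> N z <= 1 ->
  \prod_(j < k) N (vec d z j) <= 1.
Proof.
move=> vd sd z1; apply: prodr_ile1 => j _; rewrite (rnorm_ge0 S) /=.
have [<-|ej] := eqVneq e j; first by rewrite /digit_vector dfwith_in.
rewrite /digit_vector dfwith_out//; apply: (V_spec _ _).1.
by apply: valid_digit => //; rewrite sd level_lt// eq_sym.
Qed.

End digit_evaluation.

(** * The Szlenk index *)

Section szlenk.
Variables (R : realType) (K : numFieldType) (re : K -> R).
Hypothesis hK : real_or_complex re.
Variable S : scalars re.
Local Notation N := (rnorm re).

Lemma dual_norm_ge (X : normedModType K) (f : X -> K^o) x :
  N x <= 1 -> ((N (f x))%:E <= dual_norm re f)%E.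
Proof.
move=> x1; apply: ereal_sup_ubound; exists x => //.
by rewrite /unit_ball /= (rnorm_le1 S).
Qed.

Lemma szlenk_deriv_sub (X : normedModType K) eps (B : set {ptws X -> K^o}) :
  szlenk_deriv re eps B `<=` B.
Proof. by move=> f []. Qed.

Lemma szlenk_deriv_mono (X : normedModType K) eps :
  {homo @szlenk_deriv _ _ re X eps : B C / B `<=` C}.
Proof.
move=> B C BC f [Bf Vf]; split; first exact: BC.
move=> V /Vf H; apply: lt_le_trans H _; apply: le_ereal_sup.
by move=> _ [[g h] [[Bg Vg] [Bh Vh]] <-]; exists (g, h) => //; split; split => //; exact: BC.
Qed.

(** If the index at [eps] were at most [xi], the derived set at [xi] would be
    contained in an empty one. *)
Lemma szlenk_gt (X : normedModType K) (eps : {posnum R}) xi (f : {ptws X -> K^o}) :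
  derived (szlenk_deriv re eps%:num) (@dual_ball _ _ re X) xi f -> olt_infty xi (szlenk re X).
Proof.
move=> Df; rewrite /szlenk; case: pselect => //= H; exists eps => /=.
have : szlenk_at re (@dual_ball _ _ re X) eps%:num <> None.
  by move=> E; apply: H; exists eps.
rewrite /szlenk_at /omin; case: pselect => //= ex _; case: cid => b [Db _] /=.
have [bxi|//] := ole_total b xi.
have := derived_ole (@szlenk_deriv_sub X eps%:num) (@szlenk_deriv_mono X eps%:num) bxi Df.
by rewrite Db.
Qed.

Lemma functional_sum (X : normedModType K) (f : X -> K^o) (I : Type) (u : seq I) (x : I -> X) :
  linear f -> f (\sum_(y <- u) x y) = \sum_(y <- u) f (x y).
Proof.
move=> lf; elim/big_rec2: _ => [|y a b _ <-]; first exact: linear_fun0.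
by have := lf 1 (x y) b; rewrite !scale1r.
Qed.

Lemma functionalB (X : normedModType K) (f : X -> K^o) x y :
  linear f -> f (x - y) = f x - f y.
Proof. by move=> lf; rewrite addrC -scaleN1r lf scaleN1r addrC. Qed.

Variables (k L : nat) (Y : 'I_k -> completeNormedModType K).
Variables (Z : completeNormedModType K) (tau : (forall j, Y j) -> Z).
Hypothesis kE : (k = (L * 2).+1)%N.
Hypothesis infY : forall j, infinite_dimensional (Y j).
Hypothesis tauZ : is_projective_tensor_product re tau.

(** The number of derivations that the functional of a chain survives; the empty
    chain stands for the functional 0. *)
Definition chain_rank (c : seq digits) : tord :=
  if c is d :: c' then oval (last d c') else omega_pow L.

Lemma digit_chain_extend c xi : digit_chain L c -> olt xi (chain_rank c) ->
  exists d, [/\ digit_chain L (rcons c d), d \notin c & ole xi (oval d)].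
Proof.
have rt : transitive (fun d d' => dlt d' d) by move=> b a d ab bd; exact: dlt_trans bd ab.
have di d : ~~ dlt d d.
  by apply/negP => /dlt_oval - /(_ erefl); exact: olt_irr.
case: c => [_ /omega_pow_cofinal[d [vd sd xid]]|d0 c].
  by exists d; split => //; rewrite /digit_chain /= vd sd eqxx.
move=> /andP[ad]; rewrite -(sorted_pairwise rt) => pc xic.
have /andP[vl /eqP sl] := allP ad _ (mem_last d0 c).
have [d [vd sd dl xid]] := oval_cofinal vl xic.
have pcd : sorted (fun d d' => dlt d' d) (rcons (d0 :: c) d).
  by rewrite /= rcons_path; apply/andP; split.
exists d; split => //.
  rewrite /digit_chain -(sorted_pairwise rt); apply/andP; split => //.
  by rewrite all_rcons vd sd sl eqxx.
move: pcd; rewrite (sorted_pairwise rt) pairwise_rcons => /andP[/allP H _].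
by apply/negP => /H; rewrite (negbTE (di d)).
Qed.

(** By induction on [xi], every functional that extends the form of a chain of
    rank at least [xi] is in the derived set of order [xi].  At a successor, the
    chain is extended by a word [d] of rank at least [xi] and by a functional
    [h0] on the last factor that vanishes on the points occurring in finite
    approximations of the tensors that define the weak-star neighbourhood. *)
Lemma szlenk_odd_tensor_product : olt_infty (omega_pow L) (szlenk re Z).
Proof.
have k0 : (0 < k)%N by rewrite kE.
pose e : 'I_k := Ordinal (eq_ind_r (fun m => L * 2 < m)%N (ltnSn _) kE).
have eE : e.+1 = k by exact: esym kE.
have kE0 : (k + false = (L * 2).+1)%N by rewrite addn0.
have [F [V [Flin Flevel Vspec Fsep Ftri]]] := digit_system hK S kE0 eE infY.
have lvl j := pair_level_lt kE0 eE (j := j).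
pose form := digit_form (e := e) (pair_level false) F.
pose chf := chain_form (e := e) (pair_level false) F.
pose vec := digit_vector (e := e) (pair_level false) V.
(* the added forms reach [2^-1 ^+ k.-1 * 2^-1] on the unit ball; one more half
   makes the inequality on diameters strict *)
pose epsR : R := 2^-1 ^+ k.+1.
have eps0 : 0 < epsR by rewrite exprn_gt0// invr_gt0.
pose eps := PosNum eps0.
have main xi c h (f : {ptws Z -> K^o}) : digit_chain L c ->
    (forall d, linear (h d)) -> (forall d z, N (h d z) <= N z) ->
    dual_ball re f -> (forall y, f (tau y) = chf c h y) -> ole xi (chain_rank c) ->
    derived (szlenk_deriv re epsR) (@dual_ball _ _ re Z) xi f.
  elim: xi c h f => [//|xi IH|I hI g IH] c h f cc lh hN fB fE; last first.
    by move=> gc l _; apply: (IH l c h) => //; exact: gc.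
  move=> xic; split; first by apply: (IH c h) => //; exact: oltW.
  have [d [ccd dc xid]] := digit_chain_extend cc xic.
  move=> W Wf; have [r [z [t t0 tW]]] := pointwise_nbhs S Wf.
  have t2 : 0 < t / 2 by rewrite divr_gt0.
  have [u uz] := choice (fun l => tensor_approx S tauZ (z l) t2).
  (* all last components occurring in the approximations [u l] of [z l] *)
  pose ps := flatten [seq [seq (y : forall j, Y j) e | y <- u l] | l <- enum 'I_r].
  have [h0 [lh0 h0N h0p [x x1 hx]]] :=
    unit_functional_vanishing_on hK S (@infY e) (tnth (in_tuple ps)).
  have h0u l : all (fun y : forall j, Y j => h0 (y e) == 0) (u l).
    have : all (fun p => h0 p == 0) ps.
      apply/allP => p pps; have /tnthP[l' ->] : p \in in_tuple ps by exact: pps.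
      by apply/eqP; exact: h0p.
    have -> : all (fun y : forall j, Y j => h0 (y e) == 0) (u l) =
        all (fun p => h0 p == 0) [seq (y : forall j, Y j) e | y <- u l] by rewrite all_map.
    move=> /allP H; apply/allP => p pl; apply: H; apply/flatten_mapP; exists l => //.
    by rewrite mem_enum.
  have form0 l : \sum_(y <- u l) form d h0 y = 0.
    elim: (u l) (h0u l) => [|y s IHs] /=; first by rewrite big_nil.
    move=> /andP[/eqP hy /IHs E]; rewrite big_cons E addr0 /form digit_formE hy.
    by rewrite mulr0.
  pose h' d' := if d' == d then h0 else h d'.
  have lh' d' : linear (h' d') by rewrite /h'; case: eqP.
  have hN' d' y : N (h' d' y) <= N y by rewrite /h'; case: eqP.
  have chE y : chf (rcons c d) h' y = chf c h y + form d h0 y.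
    rewrite /chf /chain_form -cats1 big_cat big_seq1 /h' eqxx; congr (_ + _).
    rewrite big_seq [RHS]big_seq; apply: eq_bigr => d' d'c.
    by case: eqP => // d'd; rewrite d'd (negbTE dc) in d'c.
  have mform : multilinear (chf (rcons c d) h') by exact: chain_form_multilinear.
  have bform y : N (chf (rcons c d) h' y) <= \prod_(j < k) N (y j).
    by apply: (chain_form_bound S (L := L)) => //; exact: lvl.
  have [g gB gE] := form_extension hK S tauZ k0 mform bform.
  have [[lf fN] [lg gN]] := ((dual_ballP S f).1 fB, (dual_ballP S g).1 gB).
  have gD : derived (szlenk_deriv re epsR) (@dual_ball _ _ re Z) xi g.
    apply: (IH (rcons c d) h') => //.
    by case: (c) => [|d0 c'] //=; rewrite last_rcons.
  have fD : derived (szlenk_deriv re epsR) (@dual_ball _ _ re Z) xi f.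
    by apply: (IH c h) => //; exact: oltW.
  have gW : W g.
    apply: tW => l; pose w := \sum_(y <- u l) tau y.
    have gfw : g w = f w.
      rewrite /w (functional_sum _ _ lg) (functional_sum _ _ lf).
      rewrite (eq_bigr (fun y => f (tau y) + form d h0 y)) => [|y _]; last first.
        by rewrite gE fE; exact: chE.
      by rewrite big_split /= form0 addr0.
    have -> : g (z l) - f (z l) = g (z l - w) - f (z l - w).
      by rewrite (functionalB _ _ lg) (functionalB _ _ lf) gfw opprB addrA subrK.
    apply: le_lt_trans (rnormB S _ _) _; have := uz l; rewrite -/w => H.
    by have := gN (z l - w); have := fN (z l - w); move: H; lra.
  pose x0 := tau (vec d x).
  have vsd : valid d && (size d == L).
    by move: ccd => /andP[]; rewrite all_rcons => /andP[].
  have /andP[vd /eqP sd] := vsd.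
  have x01 : N x0 <= 1.
    apply: le_trans (elementary_tensor_norm_le S tauZ _) _.
    exact: (digit_vector_le1 kE0 eE Vspec).
  apply: (@lt_le_trans _ _ (N (g x0 - f x0))%:E).
    rewrite lte_fin; have -> : g x0 - f x0 = form d h0 (vec d x).
      by rewrite gE fE -/(chf _ _ _) chE addrC addKr.
    rewrite /form (digit_form_diagonal kE0 eE Vspec) ?orbT//.
    rewrite (rnormM S) (rnorm_emb S) /diagonal_value mul1r ?exprn_ge0 ?invr_ge0//.
    apply: lt_le_trans (_ : 2^-1 ^+ k <= _).
      by rewrite /epsR exprS gtr_pMl ?exprn_gt0 ?invr_gt0// invf_lt1 ?ltr1n.
    by rewrite -(prednK k0) exprSr ler_wpM2l ?exprn_ge0 ?invr_ge0.
  apply: le_trans (dual_norm_ge (fun x => g x - f x) x01) _.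
  apply: ereal_sup_ubound; exists (g, f) => //; split; split => //.
  exact: nbhs_singleton.
apply: (@szlenk_gt Z eps _ (fun=> 0)).
apply: (main (omega_pow L) [::] (fun _ _ => 0)) => //.
- by move=> d a y z; rewrite scaler0 addr0.
- by move=> d z; rewrite (rnorm0 S) (rnorm_ge0 S).
- apply/(dual_ballP S); split; first by move=> a y z; rewrite scaler0 addr0.
  by move=> z; rewrite (rnorm0 S) (rnorm_ge0 S).
- by move=> y; rewrite /chf /chain_form big_nil.
- exact: ole_refl.
Qed.

End szlenk.

(** * Property A *)

Lemma conjugate_exponent_lt2 (R : realType) (p : \bar R) : (2%:E < p)%E ->
  0 < fine (hoelder_conjugate p) /\ 2^-1 < (fine (hoelder_conjugate p))^-1.
Proof.
case: p => [r| |]; last 2 first.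
- by rewrite hoelder_conjugatey /= invr1 => _; split; lra.
- by [].
rewrite lte_fin => r2; have r1 : r - 1 != 0 by rewrite gt_eqF//; lra.
have r0 : r != 0 by rewrite gt_eqF//; lra.
have -> : hoelder_conjugate r%:E = (r / (r - 1))%:E.
  rewrite /hoelder_conjugate /= eqe (negbTE r0) -EFinB inver (negbTE r1) -EFinM.
  by [].
rewrite /= invf_div; split; first by rewrite divr_gt0; lra.
rewrite ltr_pdivlMr; lra.
Qed.

Lemma powR_unbounded (R : realType) (a B : R) : 0 < a ->
  exists2 n : nat, (0 < n)%N & B < n%:R `^ a.
Proof.
move=> a0; pose C := Num.max 1 B.
have C1 : 1 <= C by rewrite le_max lexx.
pose D := C `^ a^-1.
have D0 : 0 <= D by exact: powR_ge0.
exists (Num.truncn D).+1 => //.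
apply: le_lt_trans (_ : C < _); first by rewrite le_max lexx orbT.
have -> : C = D `^ a.
  by rewrite /D -powRrM mulVf ?gt_eqF// powRr1//; move: C1; lra.
apply: gt0_ltr_powR => //; rewrite ?inE ?nnegrE//=.
exact: truncnS_gt.
Qed.

Section greedy.
Variables (R : realType) (K : numFieldType) (re : K -> R) (S : scalars re).
Local Notation N := (rnorm re).

(** Since [2 v = (w + v) - (w - v)], one of the two choices of the new sign
    does not decrease the modulus below that of [v]. *)
Lemma greedy_signs n (A : nat -> nat -> K^o) : exists sg : nat -> bool,
  forall j, (j < n)%N ->
    N (A j j) <= N (\sum_(j' < j.+1) (-1) ^+ sg j' *: A j' j).
Proof.
elim: n => [|n [sg IH]]; first by exists xpredT.
pose w := \sum_(j' < n) (-1) ^+ sg j' *: A j' n.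
have [b Hb] : exists b : bool, N (A n n) <= N (w + (-1) ^+ b *: A n n).
  have [H|H] := leP (N (A n n)) (N (w + A n n)); first by exists false; rewrite expr0 scale1r.
  exists true; rewrite expr1 scaleN1r leNgt; apply/negP => H'.
  have : N (A n n + A n n) < N (A n n) + N (A n n).
    have -> : A n n + A n n = (w + A n n) - (w - A n n).
      by rewrite opprB [RHS]addrC addrA subrK.
    by apply: le_lt_trans (rnormB S _ _) _; rewrite ltrD.
  rewrite -mulr2n -scaler_nat (rnormZ S).
  have -> : N (2 : K^o) = 2 by rewrite -[2](rmorph_nat (emb S)) (rnorm_emb S).
  by rewrite -mulr2n mulr_natl ltxx.
exists (fun j => if j == n then b else sg j) => j.
rewrite ltnS leq_eqVlt => /orP[/eqP->|jn].
  rewrite big_ord_recr /= eqxx; congr (_ <= N (_ + _)): Hb.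
  by apply: eq_bigr => l _; rewrite ltn_eqF.
apply: le_trans (IH _ jn) _; rewrite le_eqVlt; apply/orP; left; apply/eqP.
congr (N _); apply: eq_bigr => l _.
by rewrite ltn_eqF//; apply: leq_ltn_trans jn; rewrite -ltnS.
Qed.

End greedy.

Lemma pairwise_mem (T : eqType) (r : rel T) (s : seq T) x y : pairwise r s ->
  x \in s -> y \in s -> x != y -> r x y \/ r y x.
Proof.
elim: s => [//|z s IH] /= /andP[/allP zs ps]; rewrite !inE.
case/orP=> [/eqP->|xs]; case/orP=> [/eqP->|ys].
- by rewrite eqxx.
- by move=> _; left; exact: zs.
- by move=> _; right; exact: zs.
- exact: IH.
Qed.

(** * Branches of the tree *)
Section branches.
Variables (M n : nat) (L : eqType).
Local Notation label := (digits * L)%type.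
Local Notation T := (@digit_tree M n L).
Variable t : 'I_n.+1 -> seq label.
Hypothesis n0 : (0 < n)%N.
Hypothesis t_max : forall j : 'I_n, proper_prefix (t (widen_ord (leqnSn n) j)) (t (lift ord0 j)) /\
  tree_max (tree_derived T (omul (omega_pow M) (ofin (n - j.+1)))) (t (lift ord0 j)).

Lemma branch_prefix (j : 'I_n.+1) : prefix (t j) (t ord_max).
Proof.
pose t' m := t (inord m).
have step m : (m < n)%N -> prefix (t' m) (t' m.+1).
  move=> mn; have [/andP[+ _] _] := t_max (Ordinal mn).
  have -> : widen_ord (leqnSn n) (Ordinal mn) = inord m.
    by apply: val_inj; rewrite /= inordK// ltnS ltnW.
  have -> // : lift ord0 (Ordinal mn) = inord m.+1.
  by apply: val_inj; rewrite /= inordK.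
have up d : forall m, (m + d <= n)%N -> prefix (t' m) (t' (m + d)%N).
  elim: d => [|d IH] m mn; first by rewrite addn0 prefix_refl.
  apply: prefix_trans (IH m _) _; first by apply: leq_trans mn; rewrite addnS.
  by rewrite addnS; apply: step; rewrite -addnS.
have := up (n - j)%N j; rewrite subnKC ?leq_ord// /t' inord_val => /(_ (leqnn _)).
have -> // : inord n = ord_max :> 'I_n.+1.
by apply: val_inj; rewrite /= inordK.
Qed.

Lemma branch_in_tree (j : 'I_n) : T (t (lift ord0 j)) /\
  ole (omul (omega_pow M) (ofin (n - j.+1))) (last_val (t (lift ord0 j))).
Proof.
have [pt [+ _]] := t_max j.
have [l0 _] : exists l0 : label, True.
  case: (t (lift ord0 j)) pt => [|l0 s _]; last by exists l0.
  by rewrite /proper_prefix prefixs0; case: eqP => // ->.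
by rewrite (digit_tree_derived _ _ l0.2) => -[].
Qed.

Lemma branch_chain : chain M n (t ord_max).
Proof.
have n1 : (n.-1 < n)%N by rewrite prednK.
have -> : ord_max = lift ord0 (Ordinal n1) :> 'I_n.+1.
  by apply: val_inj; rewrite /= /bump /= add1n prednK.
by have [/andP[]] := branch_in_tree (Ordinal n1).
Qed.

(** A node that strictly extends the previous maximal node has rank below
    [omega^M * (n - j)], and one that precedes [t (lift ord0 j)] has rank at
    least [omega^M * (n - j.+1)]; this determines its leading index. *)
Lemma branch_segment (j : 'I_n) s l0 : proper_prefix (t (widen_ord (leqnSn n) j)) s ->
  prefix s (t (lift ord0 j)) ->
  last l0 s \in t ord_max /\ (head (0, 0) (last l0 s).1).2 = (n - j.+1)%N :> nat.
Proof.
move=> ps sp; have s0 : s != [::].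
  by apply: contraTneq ps => ->; rewrite /proper_prefix prefixs0; case: eqP.
have [/andP[t0 ct] vt] := branch_in_tree j.
have cs := chain_prefix sp ct.
have Ts : T s by apply/andP.
have sb : prefix s (t ord_max) := prefix_trans sp (branch_prefix _).
split.
  case/prefixP: sb => u ->; rewrite mem_cat; case: (s) s0 => [//|x s'] _ /=.
  by rewrite mem_last.
have vs : ole (omul (omega_pow M) (ofin (n - j.+1))) (last_val s).
  apply: ole_trans vt _; have [->|st] := eqVneq s (t (lift ord0 j)); first exact: ole_refl.
  by apply: oltW; apply: last_val_lt ct => //; rewrite /proper_prefix sp.
have sv : olt (last_val s) (omul (omega_pow M) (ofin (n - j.+1).+1)).
  have [//|H] := ole_total (OSucc (last_val s)) (omul (omega_pow M) (ofin (n - j.+1).+1)).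
  have {}H : ole (omul (omega_pow M) (ofin (n - j.+1).+1)) (last_val s) by exact: H.
  exfalso; have jn := ltn_ord j.
  case: (posnP j) => [j0|j1].
    rewrite j0 subn1 prednK// in H.
    by apply: (@olt_irr (last_val s)); exact: olt_le_trans (last_val_bound Ts) H.
  have jn' : (j.-1 < n)%N by apply: leq_ltn_trans jn; exact: leq_pred.
  have [_ [_ smax]] := t_max (Ordinal jn').
  have E : lift ord0 (Ordinal jn') = widen_ord (leqnSn n) j.
    by apply: val_inj; rewrite /= /bump /= add1n prednK.
  rewrite E /= prednK// in smax.
  have /andP[pt /eqP nt] := ps; apply: nt; apply/esym/smax => //.
  rewrite (digit_tree_derived _ _ (last l0 s).2); split=> //.
  by rewrite -subSn in H.
case: (s) s0 Ts vs sv => [//|x s'] _ /andP[_ /andP[/allP/(_ _ (mem_last x s'))]] ad _.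
rewrite !last_valE => vs sv; apply: (oval_head (M := M)) => //.
by case/and3P: ad => _ /eqP.
Qed.

End branches.

(** * A weakly null tree with large convex blocks *)
Section even_tensor_product.
Variables (R : realType) (K : numFieldType) (re : K -> R).
Hypothesis hK : real_or_complex re.
Variable S : scalars re.
Local Notation N := (rnorm re).
Variables (M k : nat) (Y : 'I_k -> completeNormedModType K).
Variables (Z : completeNormedModType K) (tau : (forall j, Y j) -> Z).
Hypothesis kE : (k = M.+1 * 2)%N.
Hypothesis infY : forall j, infinite_dimensional (Y j).
Hypothesis tauZ : is_projective_tensor_product re tau.

(** All nodes of the segment number [j] of a branch have leading index
    [n - j.+1].  On their tensors the form of the words with leading index [i]
    is constant when [i = n - j.+1], because the other words of the chain do not
    contribute, and vanishes when [i > n - j.+1], because the system on the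
    unpaired factor is triangular.  These values pass to convex combinations,
    and the terms with [i < n - j.+1] are controlled by choosing signs. *)
Lemma weakly_null_tree_lower_estimate n : (0 < n)%N ->
  exists (L : eqType) (T : set (seq L)) (x : seq L -> Z),
  [/\ is_tree T, has_rank T (omul (omega_pow M) (ofin n)),
      forall s, T s -> unit_ball (x s), weakly_null T x &
      forall (t : 'I_n.+1 -> seq L) (u : 'I_n -> Z),
        (forall j : 'I_n, let a := t (widen_ord (leqnSn n) j) in let b := t (lift ord0 j) in
          [/\ proper_prefix a b,
              tree_max (tree_derived T (omul (omega_pow M) (ofin (n - j.+1)))) b &
              convex_hull [set x s | s in [set s | proper_prefix a s /\ prefix s b]] (u j)]) ->
        exists2 f : {ptws Z -> K^o}, dual_ball re f &
          forall j, (Num.sqrt n%:R)^-1 * 2^-1 ^+ k.-1 <= N (f (u j))].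
Proof.
move=> n0.
have k0 : (0 < k)%N by rewrite kE.
have ke : (k.-1 < k)%N by rewrite prednK.
pose e : 'I_k := Ordinal ke.
have eE : e.+1 = k by rewrite /= prednK.
have kE' : (k + true = (M.+1 * 2).+1)%N by rewrite addn1 -kE.
have [F [V [Flin Flevel Vspec Fsep Ftri]]] := digit_system hK S kE' eE infY.
have lvl j := pair_level_lt kE' eE (j := j).
pose form := digit_form (e := e) (pair_level true) F.
pose chf := chain_form (e := e) (pair_level true) F.
pose vec := digit_vector (e := e) (pair_level true) V.
have mtau : multilinear tau by case: tauZ.
have [z0' z01 _] := @unit_vector_in_common_kernel _ _ _ hK S (Y e) (@infY e) 0
  (fun _ _ => 0) (fun (_ : 'I_0) a v w => esym (etrans (addr0 _) (scaler0 _ a))).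
(* labels carry norm-one vectors only *)
pose U : eqType := {z : Y e | N z == 1}.
pose z0 : U := exist _ z0' (introT eqP z01).
have U1 (z : U) : N (val z) = 1 by apply/eqP; exact: (valP z).
pose X (l : digits * U) : Z := tau (vec l.1 (val l.2)).
pose l0 : digits * U := ([::], z0).
pose x (s : seq (digits * U)) : Z := X (last l0 s).
exists (digits * U)%type, (@digit_tree M n U), x; split.
- exact: digit_tree_is_tree.
- exact: digit_tree_rank.
- move=> s /andP[s0 /andP[/allP ad _]].
  have /and3P[vd /eqP sd _] : admissible M n (last l0 s).
    by apply: ad; case: (s) s0 => [//|y s'] _ /=; exact: mem_last.
  rewrite /unit_ball /= (rnorm_le1 S); apply: le_trans (elementary_tensor_norm_le S tauZ _) _.
  by apply: (digit_vector_le1 kE' eE Vspec) => //; rewrite U1.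
- move=> xi s /(digit_tree_successors z0)[d Hd].
  apply: (weak_closure_common_zero S) => r f lf.
  have [j|z z1 fz] := @unit_vector_in_common_kernel _ _ _ hK S (Y e) (@infY e) r
      (fun j z => f j (tau (vec d z))).
    by move=> a v w; rewrite (mtau e) lf.
  have z1' : N z == 1 by apply/eqP.
  exists (X (d, exist _ z z1')) => //.
  exists (rcons s (d, exist _ z z1')); last by rewrite /x last_rcons.
  split; first exact: Hd.
  by rewrite /parent size_rcons /= -cats1 take_size_cat.
- move=> t u Htu.
  have tmax j : proper_prefix (t (widen_ord (leqnSn n) j)) (t (lift ord0 j)) /\
      tree_max (tree_derived (@digit_tree M n U) (omul (omega_pow M) (ofin (n - j.+1))))
        (t (lift ord0 j)) by case: (Htu j).
  pose b := t ord_max.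
  have /andP[/allP ad sb] : chain M n b := branch_chain n0 tmax.
  pose C := map fst b.
  have rt : transitive (fun d d' => dlt d' d).
    by move=> d1 d2 d3 H1 H2; exact: dlt_trans H2 H1.
  have sC : sorted (fun d d' => dlt d' d) C by rewrite sorted_map.
  have ri : irreflexive (fun d d' => dlt d' d).
    by move=> d; apply/negP => /(dlt_oval erefl); exact: olt_irr.
  have uC : uniq C by exact: sorted_uniq rt ri _ sC.
  have adC d : d \in C -> [/\ valid d, size d = M.+1 & (digit d 0).1 = n].
    move=> /mapP[l lb ->]; have /and3P[vd /eqP sd /eqP hd] := ad _ lb.
    by split => //; rewrite /digit nth0.
  have chC : digit_chain M.+1 C.
    rewrite /digit_chain -(sorted_pairwise rt) sC andbT; apply/allP => d /adC[-> ->] _ /=.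
    exact: eqxx.
  have norming (z : U) : exists h : Y e -> K^o,
      [/\ linear h, forall y, N (h y) <= N y & h (val z) = 1].
    have zn : val z != 0.
      by apply: contra_eq_neq (U1 z) => ->; rewrite (rnorm0 S) eq_sym oner_eq0.
    have [h [lh hN hz]] := norming_functional hK S zn.
    by exists h; rewrite hz U1 rmorph1.
  have [H HP] := choice norming.
  (* the vector that the branch attaches to the word [d] *)
  pose zof d := nth z0 (map snd b) (index d C).
  have zofE l : l \in b -> zof l.1 = l.2.
    move=> lb; have il : (index l b < size b)%N by rewrite index_mem.
    rewrite -{1}(nth_index l0 lb) -[(nth l0 b _).1](nth_map l0 [::] fst)// /zof.
    by rewrite index_uniq ?size_map// (nth_map l0)// nth_index.
  (* the words of the branch with leading index [j] *)
  pose Cj j := [seq d <- C | (digit d 0).2 == j].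
  have chCj j : digit_chain M.+1 (Cj j).
    case/andP: chC => aC pC; apply/andP; split; last exact: pairwise_filter.
    by apply/allP => d; rewrite mem_filter => /andP[_]; exact: (allP aC).
  pose h d := H (zof d).
  have lh d : linear (h d) by case: (HP (zof d)).
  have hN d y : N (h d y) <= N y by have [_ hHN _] := HP (zof d); exact: hHN.
  have ext c h' : digit_chain M.+1 c -> (forall d, linear (h' d)) ->
      (forall d y, N (h' d y) <= N y) ->
      exists2 f : {ptws Z -> K^o}, dual_ball re f & forall y, f (tau y) = chf c h' y.
    move=> cc lh' hN'; apply: (form_extension hK S tauZ k0).
      exact: chain_form_multilinear.
    by move=> y; apply: (chain_form_bound S (L := M.+1)) => //; exact: lvl.
  have ext_g j := ext (Cj j) h (chCj j) lh hN.
  have [g gP] := choice (fun j => let: ex_intro2 f fB fE := ext_g j in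
    ex_intro (fun f => dual_ball re f /\ forall y, f (tau y) = chf (Cj j) h y) f (conj fB fE)).
  have lg j : linear (g j : Z -> K^o) by have /(dual_ballP S)[] := (gP j).1.
  (* the block of leading index [m] is [u l] with [l = n - m.+1]; the default
     value is never reached for [m < n] *)
  have [sg Hsg] := greedy_signs S n (fun i j => if insub (n - j.+1)%N is Some l then g i (u l) else 0).
  pose hs d y : K^o := (-1) ^+ sg (digit d 0).2 *: h d y.
  have Nsg (bb : bool) : N ((-1) ^+ bb : K^o) = 1.
    by rewrite /rnorm normrX normrN1 expr1n (re1 S).
  have [||f fB fE] := ext C hs chC.
  + by move=> d a y z; rewrite /hs lh scalerDr !scalerA [_ * a]mulrC.
  + by move=> d y; rewrite /hs (rnormZ S) Nsg mul1r.
  have lf : linear (f : Z -> K^o) by have /(dual_ballP S)[] := fB.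
  pose top (l : digits * U) := (digit l.1 0).2.
  have mC l : l \in b -> l.1 \in C by exact: map_f.
  have g_above l i : l \in b -> (top l < i)%N -> g i (X l) = 0.
    move=> lb li; have [vl sl hl] := adC _ (mC _ lb).
    rewrite /X (gP i).2; apply: big1_seq => d /andP[_]; rewrite mem_filter.
    move=> /andP[/eqP di /adC[vd sd hd]].
    by apply: (digit_form_triangular kE' eE Ftri) => //; rewrite ?hl ?hd ?di.
  have g_top l : l \in b -> g (top l) (X l) = emb S (diagonal_value R k true n).
    move=> lb; have lC := mC _ lb; have [vl sl hl] := adC _ lC.
    rewrite /X (gP _).2 /chf /chain_form (bigD1_seq l.1) ?filter_uniq//=; last first.
      by rewrite mem_filter lC andbT.
    rewrite (digit_form_diagonal kE' eE Vspec)// hl /h zofE//.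
    have [_ _ ->] := HP l.2; rewrite mulr1 big_seq_cond big1 ?addr0// => d.
    rewrite mem_filter => /andP[/andP[/eqP dl dC] dl1]; have [vd sd hd] := adC _ dC.
    apply: (digit_form_comparable kE' eE Vspec Fsep) => //.
    by case/andP: chC => _ /pairwise_mem/(_ dC lC dl1)[]; [left|right].
  have f_split l : l \in b -> f (X l) = \sum_(i < n) (-1) ^+ sg i *: g i (X l).
    move=> lb; rewrite /X fE /chf /chain_form.
    rewrite (eq_bigr (fun i : 'I_n => \sum_(d <- C | (digit d 0).2 == i)
        form d (hs d) (vec l.1 (val l.2)))) => [|i _]; last first.
      rewrite (gP i).2 /chf /chain_form big_filter scaler_sumr.
      apply: eq_bigr => d /eqP di; rewrite /form !digit_formE /hs di.
      by rewrite /GRing.scale /= mulrCA.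
    rewrite (exchange_big_dep xpredT)//= big_seq [RHS]big_seq.
    apply: eq_bigr => d /adC[vd sd hd].
    have dn : ((digit d 0).2 < n)%N by rewrite -[X in (_ < X)%N]hd valid_digit// sd.
    by rewrite (big_pred1 (Ordinal dn)).
  exists f => // j; set m := (n - j.+1)%N.
  have mn : (m < n)%N by rewrite /m; have := ltn_ord j; lia.
  have conv (phi : Z -> K^o) v : linear phi ->
      (forall l, l \in b -> top l = m -> phi (X l) = v) -> phi (u j) = v.
    move=> lphi phiv; have [_ _ [r [c [a [c0 c1 aseg ->]]]]] := Htu j.
    rewrite (linear_fun_sum _ _ _ _ lphi) -[v]scale1r -[X in X *: _]c1 scaler_suml.
    apply: eq_bigr => i _; congr (_ *: _); have [s [ps sp] <-] := aseg i.
    have [lb tl] := branch_segment n0 tmax l0 ps sp.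
    by apply: phiv => //; rewrite /top /digit nth0.
  have fu : f (u j) = \sum_(i < n) (-1) ^+ sg i *: g i (u j).
    apply/eqP; rewrite -subr_eq0; apply/eqP.
    apply: (conv (fun z => f z - \sum_(i < n) (-1) ^+ sg i *: g i z) 0).
      move=> a y z; rewrite lf scalerBr.
      have -> : \sum_(i < n) (-1) ^+ sg i *: g i (a *: y + z) =
          a *: (\sum_(i < n) (-1) ^+ sg i *: g i y) + \sum_(i < n) (-1) ^+ sg i *: g i z.
        rewrite scaler_sumr -big_split; apply: eq_bigr => i _.
        by rewrite lg scalerDr !scalerA [_ * a]mulrC.
      by rewrite opprD addrACA.
    by move=> l lb _; rewrite f_split// subrr.
  have gm : g m (u j) = emb S (diagonal_value R k true n).
    by apply: conv => // l lb <-; exact: g_top.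
  have := Hsg m mn.
  have AE i : (if insub (n - m.+1)%N is Some l then g i (u l) else 0) = g i (u j).
    have -> : (n - m.+1)%N = j by rewrite /m; have := ltn_ord j; lia.
    by rewrite valK.
  rewrite AE gm (eq_bigr (fun i : 'I_m.+1 => (-1) ^+ sg i *: g i (u j))) => [|i _]; last first.
    by rewrite AE.
  have -> : \sum_(i < m.+1) (-1) ^+ sg i *: g i (u j) = f (u j).
    rewrite fu (big_ord_widen n (fun i => (-1) ^+ sg i *: g i (u j)) mn) big_mkcond.
    apply: eq_bigr => i _; case: ltnP => // mi.
    by rewrite (conv (g i : Z -> K^o) 0) ?scaler0// => l lb tl; rewrite g_above// tl.
  by rewrite (rnorm_emb S)// /diagonal_value mulr_ge0 ?invr_ge0 ?exprn_ge0 ?sqrtr_ge0 ?invr_ge0.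
Qed.

End even_tensor_product.

(** Each of the [n] terms of the weakly summing norm is at least
    [(n^(-1/2) 2^(1-k))^q], so the norm is at least [n^(1/q - 1/2) 2^(1-k)]. *)
Lemma property_A_fails (R : realType) (K : numFieldType) (re : K -> R)
    (hK : real_or_complex re) (M k : nat) (Y : 'I_k -> completeNormedModType K)
    (Z : completeNormedModType K) (tau : (forall j, Y j) -> Z) (p : \bar R) :
  (k = M.+1 * 2)%N -> (forall j, infinite_dimensional (Y j)) ->
  is_projective_tensor_product re tau -> (2%:E < p)%E -> ~ property_A re Z M p.
Proof.
move=> kE infY tauZ /conjugate_exponent_lt2.
set q := fine _ => -[q0 q2] [alpha HA].
have [S] := scalars_exist hK.
have d0 : 0 < q^-1 - 2^-1 by rewrite subr_gt0.
have [n n0 alpha_n] := powR_unbounded (alpha * 2 ^+ k.-1) d0.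
have [L [T [x [Ttree Trank xT xnull lower]]]] :=
  weakly_null_tree_lower_estimate hK S kE infY tauZ n0.
have [t [u [_ /lower[f fB fu] ule]]] := HA n n0 L T x Ttree Trank xT xnull.
have {ule} : (\sum_(i < n) rnorm re (f (u i)) `^ q) `^ q^-1 <= alpha.
  rewrite -lee_fin; apply: le_trans ule; apply: ereal_sup_ubound.
  by exists f.
apply/negP; rewrite -ltNge.
set gam := (Num.sqrt n%:R)^-1 * 2^-1 ^+ k.-1 in fu.
have sn : 0 < Num.sqrt (n%:R : R) by rewrite sqrtr_gt0 ltr0n.
have gam0 : 0 <= gam by rewrite mulr_ge0 ?invr_ge0 ?exprn_ge0 ?invr_ge0 ?sqrtr_ge0.
apply: lt_le_trans (_ : (n%:R * gam `^ q) `^ q^-1 <= _); last first.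
  apply: ge0_ler_powR; rewrite ?invr_ge0 ?(ltW q0)// ?nnegrE.
  - by rewrite mulr_ge0 ?ler0n ?powR_ge0.
  - by apply: sumr_ge0 => i _; exact: powR_ge0.
  rewrite -[n in n%:R](card_ord n) mulr_natl -sumr_const; apply: ler_sum => i _.
  by apply: ge0_ler_powR; rewrite ?(ltW q0)// nnegrE ?(rnorm_ge0 S).
rewrite powRM ?powR_ge0// -powRrM mulfV ?gt_eqF// powRr1// /gam exprVn.
rewrite mulrA ltr_pdivlMr ?exprn_gt0//.
apply: lt_le_trans alpha_n _.
have n1 : (n%:R : R) != 0 by rewrite pnatr_eq0 -lt0n.
by rewrite powRB ?n1 ?implybT// powR12_sqrt.
Qed.

Theorem corollary5p7 (R : realType) (K : numFieldType) (re : K -> R)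
    (hK : real_or_complex re) (N : nat) (hN : (0 < N)%N) :
  (forall (Y : 'I_(2 * N - 1) -> completeNormedModType K)
          (Z : completeNormedModType K) (tau : (forall i, Y i) -> Z),
      (forall i, infinite_dimensional (Y i)) ->
      is_projective_tensor_product re tau ->
      olt_infty (omega_pow (N - 1)) (szlenk re Z)) /\
  (forall (Y : 'I_(2 * N) -> completeNormedModType K)
          (Z : completeNormedModType K) (tau : (forall i, Y i) -> Z),
      (forall i, infinite_dimensional (Y i)) ->
      is_projective_tensor_product re tau ->
      forall p : \bar R, (2%:E < p)%E -> ~ property_A re Z (N - 1) p).
Proof.
split=> [Y Z tau infY tauZ|Y Z tau infY tauZ p p2].
  have [S] := scalars_exist hK.
  have kE : (2 * N - 1 = ((N - 1) * 2).+1)%N by lia.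
  exact: (szlenk_odd_tensor_product hK S kE infY tauZ).
have kE : (2 * N = (N - 1).+1 * 2)%N by lia.
exact: (property_A_fails hK kE infY tauZ p2).
Qed.
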